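(* Let $n\ge1$ and let $\lambda$ be a partition of $d\ge 1$ with at most $n$ parts. Then the limit below exists and there is a nonzero constant $c\in\mathbb{Q}(q,t)$ (depending on $\lambda$) such that $$ \lim_{r\to t^{-1}} (1-rt)^{\ell(\lambda)-1}\, I_\lambda(X;q,t,s,r)= c\, I_\lambda(X;q,t,s), $$ where $I_\lambda(X;q,t,s)$ is the interpolation Macdonald polynomial in $X=\{x_1,\dots,x_n\}$ corresponding to $\lambda$, and $I_\lambda(X;q,t,s,r)$ is the specialization $u_\square=-s\,q^{\mathrm{col}(\square)}r^{\mathrm{row}(\square)}$ ($\square\in\lambda$) of the generic Macdonald polynomial $I_U(X)$ with $U=\{u_\square\}_{\square\in\lambda}$.
   Context: $q,t,s,r$ are independent indeterminates. A partition is identified with its diagram, whose squares $\square$ have row number $\mathrm{row}(\square)$ and column number $\mathrm{col}(\square)$, both starting from $1$; the $i$-th row of $\lambda$ has $\lambda_i$ squares, row 1 on top. $\ell(\lambda)$ is the number of nonzero parts, $|\lambda|$ the number of squares, and $\mu\subset\lambda$ means containment of diagrams. Generic Macdonald polynomials. Let $\rho(v)=\frac{(1-qv)(1-tv/q)}{(1-v)(1-tv)}$. For variables $U=\{u_\square\}$ indexed by the squares of $\lambda$, $$ I_U(X)=\sum_{f:\lambda\to\{1,\dots,n\}} \Bigl(\prod_{(\square,\square'):\, f(\square)<f(\square')}\rho(u_\square/u_{\square'})\Bigr) \prod_{\square\in\lambda} \left(x_{f(\square)} + \frac{u_\square}{t^{f(\square)}} + \frac{t^{f(\square)}}{u_\square}\right),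 $$ the sum being over all functions $f$ from the squares of $\lambda$ to $\{1,\dots,n\}$, and the first product over all pairs of squares of $\lambda$ with $f(\square)<f(\square')$. The limit $r\to t^{-1}$ is taken coefficientwise: after multiplication by $(1-rt)^{\ell(\lambda)-1}$ the coefficients are rational functions regular at $r=t^{-1}$, and they are evaluated there. Interpolation Macdonald polynomials. For a partition $\mu$ with at most $n$ parts, $I_\mu(X;q,t,s)\in\mathbb{Q}(q,t,s)[x_1,\dots,x_n]^{S(n)}$ is the nonzero symmetric polynomial of degree at most $|\mu|$ such that $I_\mu([1,\lambda_1],\dots,[n,\lambda_n])=0$ for every partition $\lambda=(\lambda_1\ge\dots\ge\lambda_n\ge 0)$ with $\mu\not\subset\lambda$, where $$[i,j]=\frac{sq^{j+1}}{t^{i+1}}+\frac{t^{i+1}}{sq^{j+1}}.$$ These conditions determine $I_\mu$ uniquely up to a constant factor; it is normalized so that its homogeneous component of degree $|\mu|$ is the ordinary Macdonald polynomial $P_\mu(x_1,\dots,x_n;q,t)$ (the coefficient of $x_1^{\mu_1}\cdots x_n^{\mu_n}$ is $1$). *)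

(* Defs.v *)
From HB Require Import structures.
From mathcomp Require Import all_boot all_order all_algebra.
From mathcomp Require Import mpoly.

Set Implicit Arguments.
Unset Strict Implicit.
Unset Printing Implicit Defensive.

Import GRing.Theory.
Local Open Scope ring_scope.

(* The field F(x) of rational functions in one indeterminate over F. *)
Definition ratfun (F : fieldType) : fieldType := {fraction {poly F}}.

Definition indet (F : fieldType) : ratfun F := tofrac ('X : {poly F}).

Definition cst (F : fieldType) (a : F) : ratfun F := tofrac a%:P.

(* z, as a rational function, is regular at a and takes the value v there.
   The fraction num / den need not be reduced; v does not depend on it. *)
Definition has_value_at (F : fieldType) (a : F) (z : ratfun F) (v : F) : Prop :=
  exists num den : {poly F},
    [/\ den.[a] != 0, z = tofrac num / tofrac den & v = num.[a] / den.[a]].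

(* The limit of a polynomial with coefficients in F(x), as x tends to a, taken
   coefficientwise. *)
Definition mpoly_limit (F : fieldType) (n : nat) (a : F)
    (P : {mpoly (ratfun F)[n]}) (Q : {mpoly F[n]}) : Prop :=
  forall m : 'X_{1..n}, has_value_at a P@_m Q@_m.

(* A partition with at most n parts is a weakly decreasing lam : 'X_{1..n},
   padded with zeros; the part lambda_i is lam at the ordinal i - 1, the size
   is mdeg lam, and x_1^lambda_1 ... x_n^lambda_n is 'X_[lam]. Containment of
   diagrams is the pointwise order (mu <= lam)%MM. *)
Definition is_partition (n : nat) (lam : 'X_{1..n}) : Prop :=
  forall i j : 'I_n, (i <= j)%N -> (lam j <= lam i)%N.

Definition part_length (n : nat) (lam : 'X_{1..n}) : nat :=
  #|[set i : 'I_n | (0 < lam i)%N]|.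

Definition square (n : nat) (lam : 'X_{1..n}) : finType :=
  {i : 'I_n & 'I_(lam i)}.

(* Rows and columns are numbered from 1, ordinals from 0. *)
Definition sq_row (n : nat) (lam : 'X_{1..n}) (x : square lam) : nat :=
  (tag x).+1.

Definition sq_col (n : nat) (lam : 'X_{1..n}) (x : square lam) : nat :=
  (tagged x).+1.

Definition rho (F : fieldType) (q t v : F) : F :=
  ((1 - q * v) * (1 - t * v / q)) / ((1 - v) * (1 - t * v)).

(* The generic Macdonald polynomial with the variables u_square replaced by
   the values u x in F. Since division is total in F, this is the
   specialization of the rational function only when the u x are nonzero and
   the denominators of rho do not vanish on ratios of distinct squares.
   The value f x : 'I_n stands for the integer f x + 1 in {1, ..., n}. *)
Definition generic_macdonald (F : fieldType) (n : nat) (lam : 'X_{1..n})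
    (q t : F) (u : square lam -> F) : {mpoly F[n]} :=
  \sum_(f : {ffun square lam -> 'I_n})
    (\prod_(p : square lam * square lam | (f p.1 < f p.2)%N)
        rho q t (u p.1 / u p.2)) *:
    \prod_(x : square lam)
      ('X_(f x) + (u x / t ^+ (f x).+1 + t ^+ (f x).+1 / u x)%:MP).

(* The specialization u_square = - s q^col r^row. When q, t, s, r are
   independent indeterminates no denominator in generic_macdonald vanishes:
   distinct squares give distinct monomials q^col r^row, and t does not occur
   in their ratios. *)
Definition macdonald_qtsr (F : fieldType) (n : nat) (lam : 'X_{1..n})
    (q t s r : F) : {mpoly F[n]} :=
  @generic_macdonald F n lam q t
    (fun x => - s * q ^+ sq_col x * r ^+ sq_row x).

(* [i, j] for 1 <= i <= n and j >= 0. *)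
Definition bracket (F : fieldType) (q t s : F) (i j : nat) : F :=
  s * q ^+ j.+1 / t ^+ i.+1 + t ^+ i.+1 / (s * q ^+ j.+1).

(* The defining conditions up to a constant factor. *)
Definition is_interpolation (F : fieldType) (n : nat) (q t s : F)
    (mu : 'X_{1..n}) (P : {mpoly F[n]}) : Prop :=
  [/\ P != 0,
      P \is symmetric,
      (msize P <= (mdeg mu).+1)%N
    & forall nu : 'X_{1..n}, is_partition nu -> ~~ (mu <= nu)%MM ->
        P.@[fun i : 'I_n => bracket q t s i.+1 (nu i)] = 0].

(* The constant factor is fixed by the coefficient of x^mu. *)
Definition is_interpolation_macdonald (F : fieldType) (n : nat) (q t s : F)
    (mu : 'X_{1..n}) (P : {mpoly F[n]}) : Prop :=
  is_interpolation q t s mu P /\ P@_mu = 1.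

Definition Qqt : fieldType := ratfun (ratfun rat).
Definition Qqts : fieldType := ratfun Qqt.
Definition Qqtsr : fieldType := ratfun Qqts.

Definition q_ : Qqts := cst (cst (indet rat)).
Definition t_ : Qqts := cst (indet (ratfun rat)).
Definition s_ : Qqts := indet Qqt.
Definition r_ : Qqtsr := indet Qqts.

(* Main.v *)
(* Two facts carry the proof.

   Symmetry. It suffices to exchange x_i and x_(i+1). Grouping the functions f
   by what they become when the value i+1 is replaced by i reduces this to two
   variables, where the sum runs over the subsets A of a set of squares. There
   one argues by induction on the number of squares, as in Liouville's theorem:
   as a function of one u_a, the difference of the two sums has at most simple
   poles. At u_a = u_b the residues cancel; at u_a = t u_b and u_a = u_b / t,
   because rho (1 / (t v)) = rho v, they are multiples of a symmetric smaller
   sum; and the terms of order u_a, 1 / u_a and 1 at infinity and at 0 vanish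
   by induction as well.

   Limit. Put tau = 1 - r t. A term f is zero unless f decreases weakly along
   the rows. Its poles at tau = 0 come from the pairs ((i+1, j), (i, j)) with
   f (i+1, j) < f (i, j), and its zeros from the pairs ((i+1, j+1), (i, j))
   with f (i+1, j+1) < f (i, j). Every pole outside the last square of a row is
   cancelled by the zero one column to the right, so the order of the pole is at
   most the length of lambda minus 1, with equality exactly when f decreases
   strictly down the columns. Thus the limit is a sum over reverse semistandard
   tableaux; the vanishing conditions hold for each tableau separately, and the
   pointwise least tableau f (i, j) = lambda'_j + 1 - i, of content lambda,
   accounts alone for the coefficient of x^lambda and for the value at lambda.
   These limits are triangular both for the monomial order and for evaluation
   at partitions, which gives uniqueness. *)
Require Import Defs.
From HB Require Import structures.
From mathcomp Require Import all_boot all_order all_algebra.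
From mathcomp Require Import mpoly.
From mathcomp Require Import fingroup perm ring zify.

Set Implicit Arguments.
Unset Strict Implicit.
Unset Printing Implicit Defensive.

Import Order.TTheory GRing.Theory.
Local Open Scope ring_scope.

(** * Two-row symmetry *)

(** [A] collects the squares sent to the smaller of two adjacent values, [D :\: A] those sent to the
    larger one; as with the condition f(x) < f(x'), [k] acts only from [A] to its complement. *)
Definition split_sum (R : comNzRingType) (T : finType) (k : T -> T -> R)
    (D : {set T}) (g h : T -> R) : R :=
  \sum_(A : {set T} | A \subset D)
    (\prod_(a in A) g a) * (\prod_(b in D :\: A) h b) *
    \prod_(a in A) \prod_(b in D :\: A) k a b.

Lemma split_sum0 (R : comNzRingType) (T : finType) (k : T -> T -> R) g h :
  split_sum k set0 g h = 1.
Proof.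
rewrite /split_sum (big_pred1 set0) => [|A]; last by rewrite subset0.
by rewrite setDv !big_set0 !mulr1.
Qed.

Lemma eq_split_sum (R : comNzRingType) (T : finType) (k k' : T -> T -> R)
    (D : {set T}) g h g' h' :
  {in D, g =1 g'} -> {in D, h =1 h'} -> {in D &, k =2 k'} ->
  split_sum k D g h = split_sum k' D g' h'.
Proof.
move=> eg eh ek; apply: eq_bigr => A /subsetP sAD.
have sDA b : b \in D :\: A -> b \in D by case/setDP.
congr (_ * _ * _).
- by apply: eq_bigr => a /sAD /eg.
- by apply: eq_bigr => b /sDA /eh.
apply: eq_bigr => a /sAD Da; apply: eq_bigr => b /sDA Db.
exact: ek.
Qed.

Lemma rmorph_split_sum (R R' : comNzRingType) (phi : {rmorphism R -> R'})
    (T : finType) (k : T -> T -> R) D g h :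
  phi (split_sum k D g h)
  = split_sum (fun a b => phi (k a b)) D (phi \o g) (phi \o h).
Proof.
rewrite /split_sum rmorph_sum; apply: eq_bigr => A _.
rewrite !rmorphM !rmorph_prod; congr (_ * _).
by apply: eq_bigr => a _; rewrite rmorph_prod.
Qed.

(** The interaction of [a] with the other elements is absorbed into the weights [h] or [g], so
    induction on the set stays within [split_sum]. *)
Lemma split_sum_setU1 (R : comNzRingType) (T : finType) (k : T -> T -> R)
    a (D : {set T}) g h :
  a \notin D ->
  split_sum k (a |: D) g h
  = g a * split_sum k D g (fun b => h b * k a b)
    + h a * split_sum k D (fun b => g b * k b a) h.
Proof.
move=> aD; rewrite {1}/split_sum (bigID (fun A : {set T} => a \in A)) /=.
congr (_ + _).
  rewrite (reindex_onto (fun A => a |: A) (fun A => A :\ a)) /=; last first.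
    by move=> A /andP[_ aA]; rewrite setD1K.
  rewrite /split_sum mulr_sumr; apply: eq_big => [A|A].
    rewrite setU11 andbT; apply/andP/idP => [[sA /eqP <-]|sA].
      by rewrite subDset.
    split; first by rewrite setUS.
    by rewrite setU1K //; apply: contraNN aD; apply: (subsetP sA).
  rewrite setU11 andbT => /andP[sA /eqP eA].
  have aA : a \notin A by rewrite -eA setD11.
  have -> : (a |: D) :\: (a |: A) = D :\: A.
    apply/setP => b; rewrite !inE negb_or.
    by case: eqP => [->|]; rewrite ?(negPf aD) ?andbF.
  rewrite !big_setU1 //= big_split /=.
  ring.
rewrite /split_sum mulr_sumr; apply: eq_big => [A|A].
  apply/andP/idP => [[sA aA]|sA].
    by rewrite -(setU1K aD) subsetD1 sA.
  rewrite (subset_trans sA (subsetUr _ _)); split=> //.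
  by apply: contraNN aD; apply: (subsetP sA).
case/andP=> _ aA.
have -> : (a |: D) :\: A = a |: (D :\: A).
  by apply/setP => b; rewrite !inE; case: eqP => [->|]; rewrite ?aA.
have aDA : a \notin D :\: A by rewrite inE (negPf aD) andbF.
rewrite big_setU1 //= big_split /=.
under [X in _ * X = _]eq_bigr do rewrite big_setU1 //=.
rewrite big_split /=; ring.
Qed.

(** Each [b] of [D] lies in exactly one of [A] and [D :\: A]. This is how common denominators are
    cleared. *)
Lemma split_sumZ (R : comNzRingType) (T : finType) (k : T -> T -> R)
    (D : {set T}) g h c :
  split_sum k D (fun b => g b * c b) (fun b => h b * c b)
  = \prod_(b in D) c b * split_sum k D g h.
Proof.
rewrite /split_sum mulr_sumr; apply: eq_bigr => A sAD.
rewrite !big_split /= [in RHS](big_setID A) (setIidPr sAD) /=.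
ring.
Qed.

Lemma coef_mul_top (R : comNzRingType) (p q : {poly R}) m n :
  (size p <= m.+1)%N -> (size q <= n.+1)%N ->
  (size (p * q)%R <= (m + n).+1)%N /\ (p * q)`_(m + n) = p`_m * q`_n.
Proof.
move=> sp sq; split.
  apply: leq_trans (size_polyMleq _ _) _.
  by rewrite -ltnS (leq_trans _ (_ : (m.+1 + n.+1 <= _)%N)) ?addnS //; lia.
have ltm : (m < (m + n).+1)%N by rewrite ltnS leq_addr.
rewrite coefM (bigD1 (Ordinal ltm)) //= addKn.
rewrite big1 ?addr0 // => i; rewrite -val_eqE /= neq_ltn.
case/orP => im.
  rewrite [q`__]nth_default ?mulr0 //; apply: leq_trans sq _; lia.
by rewrite nth_default ?mul0r // (leq_trans sp).
Qed.

Lemma split_sum_top (R : comNzRingType) (T : finType) (k : T -> T -> R) d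
    (D : {set T}) (g h : T -> {poly R}) :
  (forall b, size (g b) <= d.+1)%N -> (forall b, size (h b) <= d.+1)%N ->
  let s := split_sum (fun a b => (k a b)%:P) D g h in
  (size s <= (#|D| * d).+1)%N /\
  s`_(#|D| * d) = split_sum k D (fun b => (g b)`_d) (fun b => (h b)`_d).
Proof.
elim: {D}_.+1 {-2}D (ltnSn #|D|) g h => // n IH D; rewrite ltnS => leD g h sg sh.
have [->|/set0Pn[a Da]] := eqVneq D set0.
  by rewrite /= !split_sum0 cards0 mul0n size_poly1 coef1.
have eD := setD1K Da; set D' := D :\ a in eD.
have aD' : a \notin D' by rewrite setD11.
have cD' : #|D| = #|D'|.+1 by rewrite (cardsD1 a) Da.
have ltD' : (#|D'| < n)%N by rewrite -cD'.
rewrite -eD cardsU1 aD' add1n mulSn /= !split_sum_setU1 //.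
set f1 := fun b => h b * _; set f2 := fun b => g b * _.
have sC (p : {poly R}) c : (size p <= d.+1 -> size (p * c%:P)%R <= d.+1)%N.
  by move=> sp; rewrite mulrC mul_polyC (leq_trans (size_scale_leq _ _)).
have [s1 c1] := IH _ ltD' g f1 sg (fun b => sC _ _ (sh b)).
have [s2 c2] := IH _ ltD' f2 h (fun b => sC _ _ (sg b)) sh.
have [t1 e1] := coef_mul_top (sg a) s1.
have [t2 e2] := coef_mul_top (sh a) s2.
split; first by rewrite (leq_trans (size_polyD _ _)) // geq_max t1.
rewrite coefD e1 e2 c1 c2; congr (_ * _ + _ * _); apply: eq_split_sum => // b _;
  by rewrite coefMC.
Qed.

Lemma coefM1 (R : comNzRingType) (p q : {poly R}) :
  (p * q)`_1 = p`_0 * q`_1 + p`_1 * q`_0.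
Proof. by rewrite coefM !big_ord_recl big_ord0 /= addr0. Qed.

Lemma coef01_prod (R : comNzRingType) (I : Type) (r : seq I) (P : pred I)
    (p : I -> {poly R}) :
  (forall i, (p i)`_0 = 1) ->
  (\prod_(i <- r | P i) p i)`_0 = 1 /\
  (\prod_(i <- r | P i) p i)`_1 = \sum_(i <- r | P i) (p i)`_1.
Proof.
move=> p0; elim: r => [|i r [IH0 IH1]]; first by rewrite !big_nil !coef1.
rewrite !big_cons; case: (P i) => //.
by rewrite !coefM !big_ord_recl !big_ord0 /= /bump /= p0 IH0 IH1
   !mul1r mulr1 !addr0 addrC.
Qed.

(** A product of polynomials with constant term 1 has as linear coefficient the sum of the linear
    coefficients, whence the additive last factor. *)
Lemma split_sum_coef01 (R : comNzRingType) (T : finType) (k : T -> T -> R)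
    (D : {set T}) (g h : T -> R) (p r : T -> {poly R}) :
  (forall b, (p b)`_0 = 1) -> (forall b, (r b)`_0 = 1) ->
  let s := split_sum (fun a b => (k a b)%:P) D (fun b => (g b)%:P * p b)
             (fun b => (h b)%:P * r b) in
  s`_0 = split_sum k D g h /\
  s`_1 = \sum_(A : {set T} | A \subset D)
    (\prod_(a in A) g a) * (\prod_(b in D :\: A) h b) *
    (\prod_(a in A) \prod_(b in D :\: A) k a b) *
    (\sum_(a in A) (p a)`_1 + \sum_(b in D :\: A) (r b)`_1).
Proof.
move=> p0 r0 s.
have sE : s = \sum_(A : {set T} | A \subset D)
    ((\prod_(a in A) g a) * (\prod_(b in D :\: A) h b) *
      (\prod_(a in A) \prod_(b in D :\: A) k a b))%:P *
    ((\prod_(a in A) p a) * (\prod_(b in D :\: A) r b)).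
  apply: eq_bigr => A _; rewrite !big_split /= !polyCM !rmorph_prod /=.
  have -> : \prod_(i in A) (\prod_(b in D :\: A) k i b)%:P
     = \prod_(a in A) \prod_(b in D :\: A) (k a b)%:P.
    by apply: eq_bigr => a _; rewrite rmorph_prod.
  ring.
rewrite sE !coef_sum; split; apply: eq_bigr => A _; rewrite coefCM;
  have [a0 a1] := coef01_prod (index_enum T) (fun a => a \in A) p0;
  have [b0 b1] := coef01_prod (index_enum T) (fun b => b \in D :\: A) r0.
- by rewrite coef0M a0 b0 !mulr1.
- by rewrite coefM1 a0 b0 a1 b1 mul1r mulr1 addrC.
Qed.

(** Replacing v by 1 / (t v) divides both the numerator and the denominator of [rho] by t v^2. *)
Lemma rho_sym (F : fieldType) (q t v w : F) :
  q != 0 -> t != 0 -> v != 0 -> t * v * w = 1 -> rho q t w = rho q t v.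
Proof.
move=> q0 t0 v0 e; have -> : w = (t * v)^-1.
  by apply: (mulfI (mulf_neq0 t0 v0)); rewrite e mulfV ?mulf_neq0.
rewrite /rho.
have -> : 1 - (t * v)^-1 = - (1 - t * v) / (t * v).
  by field; rewrite t0 v0.
have -> : 1 - t * (t * v)^-1 = - (1 - v) / v by field; rewrite t0 v0.
have -> : (1 - q * (t * v)^-1) * (1 - t * (t * v)^-1 / q)
   = (1 - q * v) * (1 - t * v / q) / (t * v * v).
  by field; rewrite q0 t0 v0.
have -> : - (1 - t * v) / (t * v) * (- (1 - v) / v)
   = (1 - v) * (1 - t * v) / (t * v * v) by field; rewrite t0 v0.
by rewrite invf_div mulrA divfK // !mulf_neq0.
Qed.

(* The variable of the square b enters the row of x through u_b / w, where w is
   the power of t attached to that row. *)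
Definition row_weight (K : fieldType) (T : finType) (u : T -> K) (w x : K) b :=
  x + u b / w + w / u b.

(** With N = #|D'|, the difference of the two sides, cleared of denominators, is a polynomial in 1 /
    u_a of degree at most 3N + 2. Its coefficients in degrees 0, 1 and 3N + 2 vanish by induction,
    and it has 3N distinct nonzero roots, so it is zero. *)
Lemma two_row_symmetry (K : fieldType) (T : finType) (u : T -> K) (q t : K)
    (D : {set T}) x y :
  q != 0 -> t != 0 -> t != 1 -> t ^+ 2 != 1 -> (forall a, u a != 0) ->
  {in D &, forall a b, a != b ->
     [/\ u a != u b, u a != t * u b & u a != t ^+ 2 * u b]} ->
  let k a b := rho q t (u a / u b) in
  split_sum k D (row_weight u t x) (row_weight u (t ^+ 2) y)
  = split_sum k D (row_weight u t y) (row_weight u (t ^+ 2) x).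
Proof.
move=> q0 t0 t1 t21 u0 gen k.
set g := row_weight u t; set h := row_weight u (t ^+ 2).
elim: {D}_.+1 {-2}D (ltnSn #|D|) x y gen => // N IH D; rewrite ltnS => leD x y gen.
have [->|/set0Pn[a Da]] := eqVneq D set0; first by rewrite !split_sum0.
have eD := setD1K Da; set D' := D :\ a in eD.
have aD' : a \notin D' by rewrite setD11.
have D'D b : b \in D' -> b \in D by case/setD1P.
have cD' : #|D| = #|D'|.+1 by rewrite (cardsD1 a) Da.
have IH' (D0 : {set T}) x' y' : D0 \subset D' ->
    split_sum k D0 (g x') (h y') = split_sum k D0 (g y') (h x').
  move=> sD0; apply: IH => [|b b' /(subsetP sD0) Db /(subsetP sD0) Db'].
    by apply: leq_ltn_trans (subset_leq_card sD0) _; rewrite -cD'.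
  by apply: gen; apply: D'D.
have gen1 b0 b : b0 \in D -> b \in D -> b0 != b ->
    [/\ 1 - u b / u b0 != 0, 1 - t * (u b / u b0) != 0
      & 1 - u b / u b0 / t != 0].
  move=> D0 D1 ne; have [e1 e2 _] := gen _ _ D0 D1 ne.
  have [_ e3 _] : _ := gen _ _ D1 D0 (contra_neq esym ne).
  split; rewrite subr_eq0 eq_sym.
  - by apply: contra_neq e1 => E; rewrite -[RHS](divfK (u0 b0)) E mul1r.
  - by apply: contra_neq e2 => E; rewrite -[u b](divfK (u0 b0)) mulrA E mul1r.
  - apply: contra_neq e3 => E.
    by rewrite -[LHS](divfK (u0 b0)) -[u b / u b0](divfK t0) E mul1r.
(* The indeterminate stands for 1 / u_a: m b is the common denominator of
   rho (u_a / u_b) and rho (u_b / u_a), with numerators p b and p' b. *)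
pose L (c : K) : {poly K} := 1 - c *: 'X.
pose m b := L (u b) * L (u b / t) * L (t * u b).
pose p b := L (u b / q) * L (q * u b / t) * L (t * u b).
pose p' b := L (q * u b) * L (t * u b / q) * L (u b / t).
pose S (g' h' : T -> {poly K}) := split_sum (fun a b => (k a b)%:P) D' g' h'.
(* [c x0 w] is ['X] times the row factor of [a]. In [F] the first summand has [a] in the first row,
   the second has it in the second row. *)
pose c x0 (w : K) : {poly K} := (w^-1)%:P + x0 *: 'X + w *: 'X^2.
pose F x' y' :=
  c x' t * S (fun b => (g x' b)%:P * m b) (fun b => (h y' b)%:P * p b)
  + c y' (t ^+ 2) * S (fun b => (g x' b)%:P * p' b) (fun b => (h y' b)%:P * m b).
pose Fe x' y' D0 e :=
  (c x' t).[e] * split_sum k D0 (fun b => g x' b * (m b).[e])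
                   (fun b => h y' b * (p b).[e])
  + (c y' (t ^+ 2)).[e] * split_sum k D0 (fun b => g x' b * (p' b).[e])
                   (fun b => h y' b * (m b).[e]).
have FE x' y' e : (F x' y').[e] = Fe x' y' D' e.
  have ev G H : (S G H).[e]
      = split_sum k D' (fun b => (G b).[e]) (fun b => (H b).[e]).
    apply: etrans (rmorph_split_sum (horner_eval e) _ _ _ _) _.
    apply: eq_split_sum => [b _|b _|b b' _ _] /=; rewrite /horner_eval.
    - by [].
    - by [].
    - by rewrite hornerC.
  rewrite hornerD !hornerM !ev.
  by congr (_ * _ + _ * _); apply: eq_split_sum => // b _; rewrite hornerM hornerC.
have LE v e : (L v).[e] = 1 - v * e by rewrite !hornerE.
have cE x0 w e : (c x0 w).[e] = w^-1 + x0 * e + w * e ^+ 2.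
  by rewrite !hornerE.
have mp' b e : 1 - u b * e != 0 -> 1 - t * (u b * e) != 0 ->
   (m b).[e] * rho q t (u b * e) = (p' b).[e].
  by move=> n1 n2; rewrite !hornerM !LE /rho; field; rewrite t0 q0 n1 n2.
have mp b e : u b * e != 0 -> 1 - u b * e != 0 -> 1 - u b * e / t != 0 ->
   (m b).[e] * rho q t (u b * e)^-1 = (p b).[e].
  move=> n0 n1 n2; rewrite !hornerM !LE /rho; field.
  move: n0; rewrite mulf_eq0 negb_or => /andP[_ e0].
  rewrite t0 q0 e0 u0 -[_ - t]opprB oppr_eq0 -[_ - 1]opprB oppr_eq0 n1 andbT /=.
  by apply: contra_neq n2 => /eqP; rewrite subr_eq0 => /eqP <-; rewrite divff ?subrr.
have FaE x' y' : (F x' y').[(u a)^-1] = (u a)^-1 *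
    (\prod_(b in D') (m b).[(u a)^-1] * split_sum k D (g x') (h y')).
  rewrite FE /Fe -eD split_sum_setU1 //.
  set S1 := (X in g x' a * X + _); set S2 := (X in _ + h y' a * X).
  set M := \prod_(b in D') _.
  transitivity ((u a)^-1 * g x' a * (M * S1) + (u a)^-1 * h y' a * (M * S2));
    last by ring.
  rewrite /M /S1 /S2 -!split_sumZ.
  have nab b : b \in D' -> a != b by apply: contraTneq => <-.
  congr (_ * _ + _ * _).
  - by rewrite cE /g /row_weight; field; rewrite t0 u0.
  - apply: eq_split_sum => // b Db.
    have [n1 n2 n3] := gen1 _ _ Da (D'D _ Db) (nab _ Db).
    rewrite -mp ?mulf_neq0 ?invr_eq0 // -mulrA [_ * rho _ _ _]mulrC; congr (_ * (_ * _)).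
    by rewrite /k invf_div.
  - by rewrite cE /h /row_weight; field; rewrite t0 u0.
  - apply: eq_split_sum => // b Db.
    have [n1 n2 n3] := gen1 _ _ Da (D'D _ Db) (nab _ Db).
    by rewrite -mp' // -mulrA [_ * rho _ _ _]mulrC.
(* At 1 / u_a the polynomial [F] gives back the original sum times factors [m b], which are nonzero
   there by genericity. *)
suff P0 : F x y - F y x = 0.
  have : (F x y - F y x).[(u a)^-1] = 0 by rewrite P0 horner0.
  rewrite hornerD hornerN !FaE -!mulrBr => /eqP.
  rewrite !mulf_eq0 invr_eq0 (negPf (u0 a)) /= subr_eq0.
  case/orP => [|/eqP //]; rewrite prodf_seq_eq0 => /hasP[b _ /andP[D'b]].
  have nab : a != b by apply: contraNneq aD' => ->.
  have [n1 n2 n3] := gen1 _ _ Da (D'D _ D'b) nab.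
  rewrite !hornerM !LE !mulf_eq0 [u b / t * _]mulrAC -[t * u b * _]mulrA.
  by rewrite (negPf n1) (negPf n2) (negPf n3).
have splitD b0 : b0 \in D' -> exists D0, [/\ D' = b0 |: D0, b0 \notin D0,
    D0 \subset D' & {in D0, forall b, [/\ 1 - u b / u b0 != 0,
      1 - t * (u b / u b0) != 0 & 1 - u b / u b0 / t != 0]}].
  move=> Db0; exists (D' :\ b0); split; rewrite ?setD1K ?setD11 ?subD1set //.
  move=> b /setD1P[nb Db]; apply: gen1; rewrite ?D'D //.
  by rewrite eq_sym.
(* The residues at u_a = u_b0 cancel within each of the two sums. *)
have root1 b0 : b0 \in D' -> forall x' y', (F x' y').[(u b0)^-1] = 0.
  move=> Db0 x' y'; have [D0 [eD0 nb0 _ gen0]] := splitD _ Db0.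
  set e := (u b0)^-1.
  have m0 : (m b0).[e] = 0.
    by rewrite !hornerM !LE /e divff // subrr !mul0r.
  rewrite FE /Fe eD0 !split_sum_setU1 // m0 !mulr0 !mul0r addr0 add0r.
  set Z1 := split_sum _ _ _ _; set Z2 := split_sum _ _ _ _.
  have -> : Z2 = Z1.
    apply: eq_split_sum => // b Db; have [n1 n2 n3] := gen0 b Db.
      by rewrite -mp' // -mulrA.
    rewrite -mp ?mulf_neq0 ?invr_eq0 // -mulrA; congr (_ * (_ * _)).
    by rewrite /k /e invf_div.
  rewrite !cE !hornerM !LE /g /h /row_weight /e.
  by field; rewrite t0 q0 u0.
(* At u_a = u_b0 / t only the terms with a in the first row and b0 in the second
   survive, and their row factors form a product symmetric in x and y. *)
have root2 b0 : b0 \in D' -> (F x y - F y x).[t / u b0] = 0.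
  move=> Db0; have [D0 [eD0 nb0 sD0 gen0]] := splitD _ Db0.
  set e := t / u b0.
  have F2 x' y' : (F x' y').[e] = e * h x' b0 * h y' b0 * (p b0).[e] *
      (\prod_(b in D0) (p b).[e] * split_sum k D0 (g x') (h y')).
    have E1 : u b0 / t * e = 1 by rewrite /e; field; rewrite t0 u0.
    have m0 : (m b0).[e] = 0 by rewrite !hornerM !LE E1 subrr mulr0 mul0r.
    have p'0 : (p' b0).[e] = 0 by rewrite !hornerM !LE E1 subrr mulr0.
    rewrite FE /Fe eD0 !split_sum_setU1 // m0 p'0 !(mulr0, mul0r, addr0) add0r.
    rewrite -split_sumZ !mulrA; congr (_ * _ * _ * _).
      by rewrite cE /h /row_weight /e; field; rewrite t0 u0.
    apply: eq_split_sum => // b Db; have [n1 n2 n3] := gen0 b Db.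
    have Ee : u b * e / t = u b / u b0 by rewrite /e; field; rewrite t0 u0.
    have Et : u b * e = t * (u b / u b0) by rewrite mulrCA.
    rewrite -mp ?Ee ?mulf_neq0 ?invr_eq0 // ?Et // -[in LHS]mulrA.
    congr (_ * (_ * _)); rewrite /k.
    by apply/esym/rho_sym; rewrite ?mulf_neq0 ?invr_eq0 // mulfV ?mulf_neq0 ?invr_eq0.
  rewrite hornerD hornerN !F2 (IH' _ x y sD0); ring.
(* The mirror case u_a = t u_b0: now [a] lies in the second row and [b0] in the first. *)
have root3 b0 : b0 \in D' -> (F x y - F y x).[(t * u b0)^-1] = 0.
  move=> Db0; have [D0 [eD0 nb0 sD0 gen0]] := splitD _ Db0.
  set e := (t * u b0)^-1.
  have te : t * u b0 != 0 by rewrite mulf_neq0.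
  have F3 x' y' : (F x' y').[e] = e * g x' b0 * g y' b0 * (p' b0).[e] *
      (\prod_(b in D0) (p' b).[e] * split_sum k D0 (g x') (h y')).
    have m0 : (m b0).[e] = 0.
      by rewrite !hornerM !LE /e divff // subrr mulr0.
    have p0 : (p b0).[e] = 0.
      by rewrite !hornerM !LE /e divff // subrr mulr0.
    rewrite FE /Fe eD0 !split_sum_setU1 // m0 p0 !(mulr0, mul0r, addr0, add0r).
    rewrite -split_sumZ !mulrA; congr (_ * _ * _).
      by rewrite cE /g /row_weight /e; field; rewrite t0 u0.
    apply: eq_split_sum => // b Db; have [n1 n2 n3] := gen0 b Db.
    have Ee : t * (u b * e) = u b / u b0 by rewrite /e; field; rewrite t0 u0.
    rewrite -mp' ?Ee //; last first.
      by rewrite -[u b * e](mulKf t0) Ee [t^-1 * _]mulrC.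
    rewrite -mulrA; congr (_ * (_ * _)); rewrite /k.
    apply/esym/rho_sym => //; rewrite ?mulf_neq0 ?invr_eq0 //.
    by rewrite /e; field; rewrite t0 !u0.
  rewrite hornerD hornerN !F3 (IH' _ x y sD0); ring.
set P := F x y - F y x.
have Ltop v : (size (L v) <= 2)%N /\ (L v)`_1 = - v.
  split; last by rewrite coefB coef1 coefZ coefX mulr1 sub0r.
  rewrite (leq_trans (size_polyD _ _)) // size_polyN size_poly1 geq_max /=.
  by rewrite (leq_trans (size_scale_leq _ _)) ?size_polyX.
have L3 w v1 v2 v3 : (size (w%:P * (L v1 * L v2 * L v3))%R <= 4)%N /\
    (w%:P * (L v1 * L v2 * L v3))`_3 = w * (- (v1 * v2 * v3)).
  have [[[s1 e1] [s2 e2]] [s3 e3]] := (Ltop v1, Ltop v2, Ltop v3).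
  have [s12 e12] := coef_mul_top s1 s2; have [s123 e123] := coef_mul_top s12 s3.
  split; first by rewrite mul_polyC (leq_trans (size_scale_leq _ _)).
  by rewrite coefCM e123 e12 e1 e2 e3; ring.
have ctop x0 w : (size (c x0 w) <= 3)%N /\ (c x0 w)`_2 = w.
  split; last by rewrite !coefD coefC !coefZ coefX coefXn /= mulr0 mulr1 !add0r.
  rewrite (leq_trans (size_polyD _ _)) // geq_max.
  rewrite (leq_trans (size_polyD _ _)) ?geq_max ?(leq_trans (size_polyC_leq1 _)) //=;
  by rewrite (leq_trans (size_scale_leq _ _)) ?size_polyX ?size_polyXn.
(* The cubics [m b], [p b] and [p' b] share the leading coefficient [- u b ^+ 3], so the top
   coefficient is a multiple of the smaller sum over [D']. *)
have Ftop x' y' : (size (F x' y') <= (#|D'| * 3 + 2).+1)%N /\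
    (F x' y')`_(#|D'| * 3 + 2) = (t + t ^+ 2) *
      (\prod_(b in D') (- u b ^+ 3) * split_sum k D' (g x') (h y')).
  have [s1 e1] := split_sum_top (d := 3) k D'
    (fun b => (L3 (g x' b) (u b) (u b / t) (t * u b)).1)
    (fun b => (L3 (h y' b) (u b / q) (q * u b / t) (t * u b)).1).
  have [s2 e2] := split_sum_top (d := 3) k D'
    (fun b => (L3 (g x' b) (q * u b) (t * u b / q) (u b / t)).1)
    (fun b => (L3 (h y' b) (u b) (u b / t) (t * u b)).1).
  have [[sc1 ec1] [sc2 ec2]] := (ctop x' t, ctop y' (t ^+ 2)).
  have [z1 f1] := coef_mul_top s1 sc1; have [z2 f2] := coef_mul_top s2 sc2.
  rewrite /F ![c _ _ * _]mulrC coefD f1 f2 e1 e2 ec1 ec2; split.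
    by rewrite (leq_trans (size_polyD _ _)) // geq_max z1 z2.
  rewrite -split_sumZ mulrDl ![_ * split_sum _ _ _ _]mulrC.
  congr (_ * _ + _ * _); apply: eq_split_sum => // b _; rewrite (L3 _ _ _ _).2;
    by congr (_ * _); field; rewrite ?t0 ?q0.
have sP : (size P <= #|D'| * 3 + 2)%N.
  have [s1 e1] := Ftop x y; have [s2 e2] := Ftop y x.
  have : (size P <= (#|D'| * 3 + 2).+1)%N.
    by rewrite (leq_trans (size_polyD _ _)) // size_polyN geq_max s1.
  rewrite leq_eqVlt => /orP[/eqP sP|//].
  have : lead_coef P = 0 by rewrite lead_coefE sP coefB e1 e2 (IH' _ x y) ?subrr.
  by move/eqP; rewrite lead_coef_eq0 => /eqP ->; rewrite size_poly0.
have P_0 : P`_0 = 0.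
  rewrite -horner_coef0 hornerD hornerN !FE /Fe !cE.
  have m0 b : [/\ (m b).[0] = 1, (p b).[0] = 1 & (p' b).[0] = 1].
    by split; rewrite !hornerM !LE !mulr0 !subr0 !mulr1.
  have H x' y' G G' : (forall b, (G b).[0] = 1) -> (forall b, (G' b).[0] = 1) ->
     split_sum k D' (fun b => g x' b * (G b).[0]) (fun b => h y' b * (G' b).[0])
     = split_sum k D' (g x') (h y').
    by move=> G0 G'0; apply: eq_split_sum => // b _; rewrite ?G0 ?G'0 mulr1.
  rewrite !H; try by move=> b; case: (m0 b).
  rewrite (IH' _ x y) //; ring.
have P_1 : P`_1 = 0.
  have m0 b : [/\ (m b)`_0 = 1, (p b)`_0 = 1 & (p' b)`_0 = 1].
    by split; rewrite -horner_coef0 !hornerM !LE !mulr0 !subr0 !mulr1.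
  have m0m b : (m b)`_0 = 1 by case: (m0 b).
  have m0p b : (p b)`_0 = 1 by case: (m0 b).
  have m0p' b : (p' b)`_0 = 1 by case: (m0 b).
  have L1 v1 v2 v3 : (L v1 * L v2 * L v3)`_1 = - (v1 + v2 + v3).
    have L0 v : (L v)`_0 = 1 by rewrite -horner_coef0 LE mulr0 subr0.
    rewrite !coefM1 coef0M !(Ltop _).2 !L0; ring.
  have c01 x0 w : (c x0 w)`_0 = w^-1 /\ (c x0 w)`_1 = x0.
    by rewrite !coefD !coefC !coefZ !coefX !coefXn /= !mulr0 mulr1 !addr0 add0r.
  (* By [kapE], [b] contributes the same amount to the linear coefficient whichever row it lies in,
     so this contribution factors out of the sum over [A]. *)
  pose kap b := t^-1 * (m b)`_1 + (t ^+ 2)^-1 * (p' b)`_1.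
  have kapE b : kap b = t^-1 * (p b)`_1 + (t ^+ 2)^-1 * (m b)`_1.
    by rewrite /kap !L1; field; rewrite t0 q0.
  have F1 x' y' : (F x' y')`_1 = (x' + y' + \sum_(b in D') kap b) *
      split_sum k D' (g x') (h y').
    have [s10 s11] := split_sum_coef01 k D' (g x') (h y') m0m m0p.
    have [s20 s21] := split_sum_coef01 k D' (g x') (h y') m0p' m0m.
    have [[c0 c1] [c0' c1']] := (c01 x' t, c01 y' (t ^+ 2)).
    rewrite coefD !coefM1 c0 c1 c0' c1' /S s10 s20 s11 s21.
    rewrite /split_sum !mulr_sumr -!big_split /=.
    apply: eq_bigr => A sAD; rewrite [in RHS](big_setID A) (setIidPr sAD) /=.
    have -> : \sum_(b in D' :\: A) kap b = t^-1 * \sum_(b in D' :\: A) (p b)`_1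
       + (t ^+ 2)^-1 * \sum_(b in D' :\: A) (m b)`_1.
      by rewrite !mulr_sumr -big_split; apply: eq_bigr => b _; rewrite kapE.
    rewrite /kap big_split -!mulr_sumr /=; ring.
  rewrite coefB !F1 (IH' _ x y) //; ring.
(* These are nonzero, hence roots of [P2] in P = P2 X^2, whose size is at most 3 #|D'|; the
   conditions on [u] and [t] make them distinct. *)
pose rs := [seq (u b)^-1 | b <- enum D'] ++ [seq t / u b | b <- enum D']
   ++ [seq (t * u b)^-1 | b <- enum D'].
have [P2 eP2] : exists P2, P = P2 * 'X^2.
  exists (drop_poly 2 P); rewrite -[LHS](poly_take_drop 2 P).
  suff -> : take_poly 2 P = 0 by rewrite add0r.
  by apply/polyP => -[|[|i]]; rewrite coef_take_poly coef0.
have : P2 = 0; last by move=> P20; rewrite eP2 P20 mul0r.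
apply/eqP; apply: contraTT isT => P2n0.
have : (size rs < size P2)%N.
  apply: max_poly_roots => //.
    apply/allP => e rse.
    have : P.[e] = 0 /\ e != 0.
      move: rse; rewrite !mem_cat => /or3P[] /mapP[b]; rewrite mem_enum => Db ->.
      - by rewrite hornerD hornerN !root1 // subr0 invr_eq0.
      - by rewrite root2 // mulf_neq0 ?invr_eq0.
      - by rewrite root3 // invr_eq0 mulf_neq0.
    rewrite eP2 hornerM hornerXn => -[/eqP]; rewrite mulf_eq0 expf_eq0 /=.
    by case/orP => [//|->].
  have injm f : (forall b b', b \in D' -> b' \in D' -> f b = f b' -> u b = u b') ->
      uniq [seq f b | b <- enum D'].
    move=> fi; rewrite map_inj_in_uniq ?enum_uniq // => b b'.
    rewrite !mem_enum => Db Db' /(fi _ _ Db Db') E; apply/eqP.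
    apply: contraTT isT => nb; have [] := gen _ _ (D'D _ Db) (D'D _ Db') nb.
    by rewrite E eqxx.
  have disj (f f' : T -> K) : (forall b b', b \in D' -> b' \in D' -> f b != f' b') ->
      ~~ has (mem [seq f b | b <- enum D']) [seq f' b | b <- enum D'].
    move=> fd; apply/hasPn => _ /mapP[b' Db' ->]; apply/mapP => -[b Db /esym/eqP].
    by apply/negP; apply: fd; rewrite -mem_enum.
  have tne b b' : b \in D' -> b' \in D' -> u b != t * u b' /\ u b != t ^+ 2 * u b'.
    move=> Db Db'; have [->|nb] := eqVneq b b'; last first.
      by case: (gen _ _ (D'D _ Db) (D'D _ Db') nb).
    by split; rewrite -{1}[u b']mul1r (inj_eq (mulIf (u0 _))) eq_sym.
  have inj1 b b' : b \in D' -> b' \in D' -> (u b)^-1 = (u b')^-1 -> u b = u b'.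
    by move=> _ _ /invr_inj.
  have inj2 b b' : b \in D' -> b' \in D' -> t / u b = t / u b' -> u b = u b'.
    by move=> _ _ /(mulfI t0)/invr_inj.
  have inj3 b b' : b \in D' -> b' \in D' ->
      (t * u b)^-1 = (t * u b')^-1 -> u b = u b'.
    by move=> _ _ /invr_inj /(mulfI t0).
  have disj1 b b' : b \in D' -> b' \in D' -> (u b)^-1 != t / u b'.
    move=> Db Db'; have [n1 _] := tne b' b Db' Db.
    by apply: contra_neq n1 => E; rewrite -[RHS]invrK invfM E mulKf // invrK.
  have disj2 b b' : b \in D' -> b' \in D' -> (u b)^-1 != (t * u b')^-1.
    by move=> Db Db'; rewrite (inj_eq invr_inj); case: (tne b b' Db Db').
  have disj3 b b' : b \in D' -> b' \in D' -> t / u b != (t * u b')^-1.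
    move=> Db Db'; have [_ n1] := tne b b' Db Db'.
    apply: contra_neq n1 => E.
    by rewrite expr2 -mulrA -[t * u b']invrK -E invf_div mulrCA divff // mulr1.
  by rewrite !cat_uniq has_cat negb_or !injm ?disj.
move: sP; rewrite eP2 size_mulXn // !size_cat !size_map -cardE; lia.
Qed.

(** * Symmetry of the generic Macdonald polynomials *)

(** Adjacent transpositions generate: (i, j+1) is the conjugate of (i, j) by (j, j+1). *)
Lemma adjacent_tperm_ind n (P : 'S_n -> Prop) :
  P 1%g -> (forall s s', P s -> P s' -> P (s * s')%g) ->
  (forall i j : 'I_n, j = i.+1 :> nat -> P (tperm i j)) ->
  forall s, P s.
Proof.
move=> P1 PM Padj.
have Plt (i j : 'I_n) : (i < j)%N -> P (tperm i j).
  case: j => j ltjn; rewrite [nat_of_ord (Ordinal _)]/=.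
  elim: j ltjn => // j IH ltjn; rewrite ltnS leq_eqVlt => /orP[/eqP ij|ij].
    by apply: Padj; rewrite ij.
  have ltj : (j < n)%N by apply: ltnW.
  set j1 := Ordinal ltjn; pose j0 := Ordinal ltj.
  have -> : tperm i j1 = (tperm i j0 ^ tperm j0 j1)%g.
    rewrite tpermJ tpermL tpermD //; apply/eqP => /(congr1 val) /=; lia.
  rewrite /conjg tpermV; apply: (PM); first exact: Padj.
  by apply: PM; [exact: IH|exact: Padj].
move=> s; have [ts -> _] := prod_tpermP s.
elim: ts => [|[i j] ts IH]; first by rewrite big_nil.
rewrite big_cons; apply: PM IH => /=.
case: (ltngtP i j) => [||/val_inj ->]; first exact: Plt.
  by rewrite tpermC; apply: Plt.
by rewrite tperm1.
Qed.

(** The generic Macdonald sum with field elements [z i] in place of the variables, so that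
    [two_row_symmetry] applies to it. *)
Definition coloring_sum (K : fieldType) (T : finType) n (q t : K) (u : T -> K)
    (z : 'I_n -> K) : K :=
  \sum_(f : {ffun T -> 'I_n})
    (\prod_(p : T * T | (f p.1 < f p.2)%N) rho q t (u p.1 / u p.2)) *
    \prod_x row_weight u (t ^+ (f x).+1) (z (f x)) x.

Lemma eq_coloring_sum (K : fieldType) (T : finType) n (q t : K) (u : T -> K)
    (z z' : 'I_n -> K) : z =1 z' -> coloring_sum q t u z = coloring_sum q t u z'.
Proof.
move=> ez; apply: eq_bigr => f _; congr (_ * _).
by apply: eq_bigr => x _; rewrite ez.
Qed.

Lemma coloring_sum_adjacent (K : fieldType) (T : finType) n (q t : K)
    (u : T -> K) (z : 'I_n -> K) (i j : 'I_n) :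
  q != 0 -> t != 0 -> t != 1 -> t ^+ 2 != 1 -> (forall a, u a != 0) ->
  (forall a b, a != b ->
     [/\ u a != u b, u a != t * u b & u a != t ^+ 2 * u b]) ->
  j = i.+1 :> nat ->
  coloring_sum q t u (z \o tperm i j) = coloring_sum q t u z.
Proof.
move=> q0 t0 t1 t21 u0 gen ji.
have nij : i != j by apply/eqP => /(congr1 val); rewrite /= ji; lia.
(* The fibre of c over f0 is indexed by the subsets A of D: f takes the value i
   on A and j on the rest of D. *)
pose c (f : {ffun T -> 'I_n}) := [ffun x => if f x == j then i else f x].
rewrite /coloring_sum (partition_big c predT) //= [RHS](partition_big c predT) //=.
apply: eq_bigr => f0 _.
have [/existsP[x0 /eqP f0j]|] := boolP [exists x, f0 x == j].
  have nof f : (c f == f0) = false.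
    apply/eqP => /ffunP/(_ x0); rewrite ffunE f0j.
    by case: eqP => // _ E; move: nij; rewrite E eqxx.
  by rewrite !big_pred0.
rewrite negb_exists => /forallP f0j.
pose D := [set x | f0 x == i].
pose fA (A : {set T}) := [ffun x => if x \in D :\: A then j else f0 x].
have fiber z' : \sum_(f | c f == f0)
    (\prod_(p : T * T | (f p.1 < f p.2)%N) rho q t (u p.1 / u p.2)) *
    \prod_x row_weight u (t ^+ (f x).+1) (z' (f x)) x
  = (\prod_(p : T * T | (f0 p.1 < f0 p.2)%N) rho q t (u p.1 / u p.2)) *
    (\prod_(x in ~: D) row_weight u (t ^+ (f0 x).+1) (z' (f0 x)) x) *
    split_sum (fun a b => rho q t (u a / u b)) D
      (row_weight u (t ^+ i.+1) (z' i)) (row_weight u (t ^+ j.+1) (z' j)).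
  rewrite (reindex_onto fA (fun f => [set x | f x == i])) /=; last first.
    move=> f /eqP /ffunP cf; apply/ffunP => x; rewrite ffunE !inE -cf ffunE.
    by case: (f x =P j) => [->|]; rewrite ?eqxx ?(negPf nij) ?[j == i]eq_sym
      ?(negPf nij) //= andNb.
  rewrite /split_sum mulr_sumr; apply: eq_big => [A|A].
    apply/andP/idP => [[_ /eqP/setP eA]|/subsetP sA].
      apply/subsetP => x; rewrite -eA !inE ffunE !inE.
      by case: ifP => // _; rewrite eq_sym (negPf nij).
    split; apply/eqP.
      apply/ffunP => x; rewrite !ffunE; have [|_] := boolP (x \in D :\: A).
        by rewrite !inE => /andP[_ /eqP ->]; rewrite eqxx.
      by rewrite (negPf (f0j x)).
    apply/setP => x; rewrite !inE ffunE !inE.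
    case xA: (x \in A) => /=; first by have := sA x xA; rewrite inE.
    have [e|/negPf ne] /= := eqVneq (f0 x) i; last exact: ne.
    by rewrite eq_sym (negPf nij).
  case/andP=> _ /eqP eA.
  have sA x : x \in A -> f0 x = i.
    rewrite -eA !inE ffunE !inE; case: ifP => [_|_ /eqP //].
    by rewrite eq_sym (negPf nij).
  have sAD : A \subset D by apply/subsetP => x /sA xi; rewrite inE xi.
  (* [f0] avoids [j], the successor of [i]. Raising some values [i] to [j] therefore keeps every
     strict inequality of [f0] and creates new ones exactly from [A] to [D :\: A]. *)
  rewrite (bigID (fun p : T * T => (f0 p.1 < f0 p.2)%N)) /=.
  rewrite (bigID (fun x => x \in D)) /= [\prod_(x in D) _](big_setID A) (setIidPr sAD) /=.
  rewrite pair_big_dep /=.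
  have fE x : fA A x = if (x \notin A) && (f0 x == i) then j else f0 x.
    by rewrite ffunE !inE.
  have vE x : [/\ f0 x != j :> nat, (f0 x == i) = (f0 x == i :> nat) &
      x \in A -> f0 x = i :> nat].
    by split=> //; [exact: f0j | move/sA ->].
  set X1 := \prod_(p | _ && (f0 p.1 < f0 p.2)%N) _.
  have -> : X1 = \prod_(p : T * T | (f0 p.1 < f0 p.2)%N) rho q t (u p.1 / u p.2).
    apply: eq_bigl => p; rewrite !fE.
    have [[n1 e1 i1] [n2 e2 i2]] := (vE p.1, vE p.2); rewrite e1 e2.
    case: ifP; case: ifP; lia.
  set X2 := \prod_(p | _ && ~~ (f0 p.1 < f0 p.2)%N) _.
  have -> : X2 = \prod_(p | (p.1 \in A) && (p.2 \in D :\: A)) rho q t (u p.1 / u p.2).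
    apply: eq_bigl => p; rewrite !inE !fE.
    have [[n1 e1 i1] [n2 e2 i2]] := (vE p.1, vE p.2); rewrite e1 e2.
    move: i1 i2; case: (p.1 \in A); case: (p.2 \in A) => /= i1 i2;
      try have {}i1 := i1 isT; try have {}i2 := i2 isT;
      by repeat case: ifP; lia.
  have -> : \prod_(x in A) row_weight u (t ^+ (fA A x).+1) (z' (fA A x)) x
      = \prod_(x in A) row_weight u (t ^+ i.+1) (z' i) x.
    by apply: eq_bigr => x xA; rewrite fE xA /= sA.
  have -> : \prod_(x in D :\: A) row_weight u (t ^+ (fA A x).+1) (z' (fA A x)) x
      = \prod_(x in D :\: A) row_weight u (t ^+ j.+1) (z' j) x.
    by apply: eq_bigr => x; rewrite !inE fE => ->.
  have -> : \prod_(x | x \notin D) row_weight u (t ^+ (fA A x).+1) (z' (fA A x)) x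
      = \prod_(x in ~: D) row_weight u (t ^+ (f0 x).+1) (z' (f0 x)) x.
    apply: eq_big => [x|x]; first by rewrite !inE.
    by rewrite !inE fE => /negPf ->; rewrite andbF.
  ring.
have nD x : x \in ~: D -> tperm i j (f0 x) = f0 x.
  by rewrite !inE => nx; rewrite tpermD // eq_sym.
rewrite (fiber z) (fiber (z \o tperm i j)); congr (_ * _ * _).
  by apply: eq_bigr => x Dx; rewrite /= nD.
rewrite /= tpermL tpermR ji.
(* Rescaling by t^i turns the row weights t^(i+1) and t^(i+2) into t and t^2, and leaves the ratios
   inside [rho] unchanged. *)
pose u' x := u x / t ^+ i.
have ti0 : t ^+ i != 0 by rewrite expf_neq0.
have wE k x : row_weight u (t ^+ i * t ^+ k) x =1 row_weight u' (t ^+ k) x.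
  move=> b; rewrite /row_weight /u' invf_div; field.
  by rewrite u0 ti0 expf_neq0.
have kE a b : rho q t (u a / u b) = rho q t (u' a / u' b).
  by congr rho; rewrite /u'; field; rewrite u0 ti0.
have SE x y : split_sum (fun a b => rho q t (u a / u b)) D
      (row_weight u (t ^+ i.+1) x) (row_weight u (t ^+ i.+2) y)
    = split_sum (fun a b => rho q t (u' a / u' b)) D
      (row_weight u' t x) (row_weight u' (t ^+ 2) y).
  apply: eq_split_sum => [b _|b _|b b' _ _]; last exact: kE.
    by rewrite -[t in RHS]expr1 -wE -exprD addn1.
  by rewrite -wE -exprD addn2.
rewrite !SE; apply: two_row_symmetry => //.
  by move=> a; rewrite mulf_neq0 ?invr_eq0.
move=> a b _ _ /gen[n1 n2 n3].
by split; rewrite /u' ?mulrA (inj_eq (mulIf _)) ?invr_eq0.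
Qed.

Lemma coloring_sum_symmetric (K : fieldType) (T : finType) n (q t : K)
    (u : T -> K) (s : 'S_n) (z : 'I_n -> K) :
  q != 0 -> t != 0 -> t != 1 -> t ^+ 2 != 1 -> (forall a, u a != 0) ->
  (forall a b, a != b ->
     [/\ u a != u b, u a != t * u b & u a != t ^+ 2 * u b]) ->
  coloring_sum q t u (z \o s) = coloring_sum q t u z.
Proof.
move=> q0 t0 t1 t21 u0 gen; move: s z.
apply: adjacent_tperm_ind => [z|s s' IH IH' z|i j ji z].
- by apply: eq_coloring_sum => x; rewrite /= perm1.
- rewrite -[RHS]IH' -[RHS]IH; apply: eq_coloring_sum => x.
  by rewrite /= permM.
- exact: coloring_sum_adjacent.
Qed.

Lemma fmorph_rho (F K : fieldType) (phi : {rmorphism F -> K}) (q t v : F) :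
  phi (rho q t v) = rho (phi q) (phi t) (phi v).
Proof.
by rewrite /rho !(fmorph_div, rmorphM, rmorphB, rmorph1).
Qed.

(** The identity is checked in the fraction field of the polynomial ring, into which that ring
    embeds and where the variables are field elements. *)
Lemma generic_macdonald_symmetric (F : fieldType) n (lam : 'X_{1..n})
    (q t : F) (u : square lam -> F) :
  q != 0 -> t != 0 -> t != 1 -> t ^+ 2 != 1 -> (forall a, u a != 0) ->
  (forall a b, a != b ->
     [/\ u a != u b, u a != t * u b & u a != t ^+ 2 * u b]) ->
  generic_macdonald q t u \is symmetric.
Proof.
move=> q0 t0 t1 t21 u0 gen.
pose phi : {rmorphism F -> {fraction {mpoly F[n]}}} := (@tofrac _) \o (@mpolyC n F).
pose Q (w : 'I_n -> {mpoly F[n]}) :=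
  \sum_(f : {ffun square lam -> 'I_n})
    (\prod_(p : square lam * square lam | (f p.1 < f p.2)%N)
        rho q t (u p.1 / u p.2)) *:
    \prod_(x : square lam)
      (w (f x) + (u x / t ^+ (f x).+1 + t ^+ (f x).+1 / u x)%:MP).
have QE w : tofrac (Q w) = coloring_sum (phi q) (phi t) (phi \o u) ((@tofrac _) \o w).
  rewrite /Q rmorph_sum; apply: eq_bigr => f _.
  rewrite -mul_mpolyC rmorphM; congr (_ * _).
    rewrite -[LHS]/(phi _) rmorph_prod; apply: eq_bigr => p _.
    by rewrite fmorph_rho fmorph_div.
  rewrite rmorph_prod; apply: eq_bigr => x _; rewrite rmorphD.
  rewrite [X in _ + X](_ : _ = phi (u x / t ^+ (f x).+1 + t ^+ (f x).+1 / u x)) //.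
  by rewrite rmorphD !fmorph_div !rmorphXn addrA.
apply/issymP => s; apply/eqP; rewrite -tofrac_eq; apply/eqP.
have -> : msym s (generic_macdonald q t u) = Q (fun i => 'X_(s i)).
  rewrite /generic_macdonald rmorph_sum /=; apply: eq_bigr => f _.
  rewrite msymZ rmorph_prod /=; congr (_ *: _); apply: eq_bigr => x _.
  by rewrite rmorphD /= /msym mmapX mmap1U mmapC.
rewrite -[generic_macdonald q t u]/(Q (fun i => 'X_i)) !QE.
rewrite -(coloring_sum_symmetric s ((@tofrac _) \o (fun i : 'I_n => 'X_i))) ?fmorph_eq0
  ?fmorph_eq1 -?rmorphXn ?fmorph_eq1 //.
- by move=> a; have := u0 a; rewrite -(fmorph_eq0 phi).
- move=> a b /gen[n1 n2 n3].
  by split; [move: n1|move: n2|move: n3]; rewrite -(fmorph_eq phi) // rmorphM.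
Qed.

(** * Values of rational functions and of the weights *)

Section Values.
Variables (F : fieldType) (a : F).
Implicit Types (z : ratfun F) (v : F).

Definition cst_morph : {rmorphism F -> ratfun F} := (@tofrac _) \o (@polyC F).

Lemma value_cst v : has_value_at a (cst v) v.
Proof.
by exists v%:P, 1; rewrite !hornerE oner_eq0 rmorph1 !divr1.
Qed.

Lemma value_indet : has_value_at a (indet F) a.
Proof.
by exists 'X, 1; rewrite !hornerE oner_eq0 rmorph1 !divr1.
Qed.

Lemma value_den_neq0 (d : {poly F}) : d.[a] != 0 -> tofrac d != 0.
Proof. by rewrite tofrac_eq0; apply: contra_neq => ->; rewrite horner0. Qed.

Lemma valueD z1 v1 z2 v2 : has_value_at a z1 v1 -> has_value_at a z2 v2 ->
  has_value_at a (z1 + z2) (v1 + v2).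
Proof.
move=> [n1 [d1 [h1 -> ->]]] [n2 [d2 [h2 -> ->]]].
exists (n1 * d2 + n2 * d1), (d1 * d2); split.
- by rewrite hornerM mulf_neq0.
- by rewrite addf_div ?value_den_neq0 // rmorphD !rmorphM.
- by rewrite addf_div // hornerD !hornerM.
Qed.

Lemma valueM z1 v1 z2 v2 : has_value_at a z1 v1 -> has_value_at a z2 v2 ->
  has_value_at a (z1 * z2) (v1 * v2).
Proof.
move=> [n1 [d1 [h1 -> ->]]] [n2 [d2 [h2 -> ->]]].
exists (n1 * n2), (d1 * d2); split.
- by rewrite hornerM mulf_neq0.
- by rewrite mulf_div !rmorphM.
- by rewrite mulf_div !hornerM.
Qed.

Lemma valueN z v : has_value_at a z v -> has_value_at a (- z) (- v).
Proof.
by move=> [n [d [h -> ->]]]; exists (- n), d; rewrite rmorphN hornerN !mulNr.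
Qed.

Lemma valueB z1 v1 z2 v2 : has_value_at a z1 v1 -> has_value_at a z2 v2 ->
  has_value_at a (z1 - z2) (v1 - v2).
Proof. by move=> h1 /valueN; apply: valueD. Qed.

Lemma valueV z v : v != 0 -> has_value_at a z v -> has_value_at a z^-1 v^-1.
Proof.
move=> v0 [n [d [h -> e]]]; exists d, n; rewrite e !invf_div; split=> //.
by apply: contraNneq v0 => n0; rewrite e n0 mul0r.
Qed.

Lemma value_div z1 v1 z2 v2 : v2 != 0 -> has_value_at a z1 v1 ->
  has_value_at a z2 v2 -> has_value_at a (z1 / z2) (v1 / v2).
Proof. by move=> v0 h1 /(valueV v0); apply: valueM. Qed.

Lemma value0 : has_value_at a 0 0.
Proof. by have := value_cst 0; rewrite -[cst 0]/(cst_morph 0) rmorph0. Qed.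

Lemma value1 : has_value_at a 1 1.
Proof. by have := value_cst 1; rewrite -[cst 1]/(cst_morph 1) rmorph1. Qed.

Lemma value_sum (I : Type) (r : seq I) (P : pred I) zs vs :
  (forall i, P i -> has_value_at a (zs i) (vs i)) ->
  has_value_at a (\sum_(i <- r | P i) zs i) (\sum_(i <- r | P i) vs i).
Proof. by move=> h; elim/big_rec2: _ => [|i z v /h]; [exact: value0|exact: valueD]. Qed.

Lemma value_prod (I : Type) (r : seq I) (P : pred I) zs vs :
  (forall i, P i -> has_value_at a (zs i) (vs i)) ->
  has_value_at a (\prod_(i <- r | P i) zs i) (\prod_(i <- r | P i) vs i).
Proof. by move=> h; elim/big_rec2: _ => [|i z v /h]; [exact: value1|exact: valueM]. Qed.

Lemma valueX z v k : has_value_at a z v -> has_value_at a (z ^+ k) (v ^+ k).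
Proof.
move=> h; elim: k => [|k IH]; rewrite ?expr0 ?exprS; first exact: value1.
exact: valueM.
Qed.

Lemma value_unique z v v' : has_value_at a z v -> has_value_at a z v' -> v = v'.
Proof.
move=> [n [d [h -> ->]]] [n' [d' [h' e ->]]].
have {e}: n * d' = n' * d.
  apply/eqP; rewrite -tofrac_eq !rmorphM /= -eqr_div ?value_den_neq0 //.
  exact/eqP.
by move=> /(congr1 (horner^~ a)); rewrite !hornerM => e; apply/eqP; rewrite eqr_div // e.
Qed.

Variable n : nat.
Implicit Types (P : {mpoly (ratfun F)[n]}) (Q : {mpoly F[n]}).

Lemma limit_sum (I : Type) (r : seq I) (p : pred I) Ps Qs :
  (forall i, p i -> mpoly_limit a (Ps i : {mpoly (ratfun F)[n]}) (Qs i)) ->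
  mpoly_limit a (\sum_(i <- r | p i) Ps i) (\sum_(i <- r | p i) Qs i).
Proof. by move=> h m; rewrite !raddf_sum /=; apply: value_sum => i /h; apply. Qed.

Lemma limitD P1 Q1 P2 Q2 : mpoly_limit a P1 Q1 -> mpoly_limit a P2 Q2 ->
  mpoly_limit a (P1 + P2) (Q1 + Q2).
Proof. by move=> h1 h2 m; rewrite !mcoeffD; apply: valueD. Qed.

Lemma limitC z v : has_value_at a z v -> mpoly_limit a z%:MP_[n] v%:MP_[n].
Proof.
move=> h m; rewrite !mcoeffC; apply: valueM => //.
by case: (m == 0%MM); [exact: value1|exact: value0].
Qed.

Lemma limit_mon m : mpoly_limit a ('X_[m] : {mpoly (ratfun F)[n]}) 'X_[m].
Proof.
by move=> k; rewrite !mcoeffX; case: (m == k); [exact: value1|exact: value0].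
Qed.

Lemma limitM P1 Q1 P2 Q2 : mpoly_limit a P1 Q1 -> mpoly_limit a P2 Q2 ->
  mpoly_limit a (P1 * P2) (Q1 * Q2).
Proof. by move=> h1 h2 m; rewrite !mcoeffM; apply: value_sum => k _; apply: valueM. Qed.

Lemma limitZ z v P Q : has_value_at a z v -> mpoly_limit a P Q ->
  mpoly_limit a (z *: P) (v *: Q).
Proof. by move=> h1 h2 m; rewrite !mcoeffZ; apply: valueM. Qed.

Lemma limit_prod (I : Type) (r : seq I) (p : pred I) Ps Qs :
  (forall i, p i -> mpoly_limit a (Ps i : {mpoly (ratfun F)[n]}) (Qs i)) ->
  mpoly_limit a (\prod_(i <- r | p i) Ps i) (\prod_(i <- r | p i) Qs i).
Proof.
move=> h; elim/big_rec2: _ => [|i Q P /h]; last exact: limitM.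
exact: limitC value1.
Qed.

(** Permuting the variables permutes coefficients, and the value of each coefficient at [a] is
    unique. *)
Lemma limit_symmetric P Q :
  mpoly_limit a P Q -> P \is symmetric -> Q \is symmetric.
Proof.
move=> h /issymP sP; apply/issymP => s; apply/mpolyP => m.
rewrite mcoeff_sym; apply: value_unique (h _) _.
rewrite -mcoeff_sym sP; exact: h.
Qed.

End Values.

(** Distinct monomials take distinct values. The quantities shown nonzero below come down to
    differences of two monomials. *)
Definition independent (F : fieldType) (q t s : F) :=
  forall i j k i' j' k', s ^+ i * q ^+ j * t ^+ k = s ^+ i' * q ^+ j' * t ^+ k' ->
  [/\ i = i', j = j' & k = k'].

Lemma cst_indet_inj (F : fieldType) (c c' : F) i i' :
  c != 0 -> cst c * indet F ^+ i = cst c' * indet F ^+ i' -> i = i' /\ c = c'.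
Proof.
move=> c0; rewrite /cst /indet -!rmorphXn -!rmorphM => /eqP; rewrite tofrac_eq.
rewrite !mul_polyC => /eqP E.
have := congr1 (fun p : {poly F} => p`_i) E.
rewrite !coefZ !coefXn eqxx mulr1; case: eqP => [->|_]; rewrite ?mulr1 //.
by rewrite mulr0 => /eqP; rewrite (negPf c0).
Qed.

(** The tower of rational function fields is peeled from the outside: first the exponent of s, then
    that of t, then that of q. *)
Lemma independent_qts : independent q_ t_ s_.
Proof.
move=> i j k i' j' k'; rewrite /q_ /t_ /s_.
have cM (F : fieldType) (x y : F) j0 k0 :
    cst x ^+ j0 * cst y ^+ k0 = cst (x ^+ j0 * y ^+ k0).
  by rewrite -[cst _]/(cst_morph _ _) -[cst _]/(cst_morph _ _) -!rmorphXn -rmorphM.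
have i0 (F : fieldType) : indet F != 0 by rewrite tofrac_eq0 polyX_eq0.
have c0 (F : fieldType) (x : F) : (cst x == 0) = (x == 0).
  exact: (fmorph_eq0 (cst_morph F)).
rewrite -!mulrA !cM ![indet _ ^+ _ * _]mulrC => /cst_indet_inj[].
  by rewrite mulf_neq0 ?expf_neq0 ?c0 // i0.
move=> -> /=.
have cX (F : fieldType) (x : F) j0 : cst x ^+ j0 = cst (x ^+ j0).
  by rewrite -[cst x]/(cst_morph _ x) -rmorphXn.
rewrite !cX => /cst_indet_inj[]; first by rewrite expf_neq0 // i0.
move=> -> E; have [|-> _] // := @cst_indet_inj rat 1 1 j j' (oner_neq0 _).
by rewrite E.
Qed.

(** For a square just below another the ratio is r, and 1 - t r divides the denominator of [rho].
    For one just below and to the right, as in [is_zero], the ratio is q r, and the numerator factor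
    1 - t (q r) / q equals 1 - t r. *)
Definition is_pole (c1 k1 c2 k2 : nat) : bool := (k1 == k2.+1) && (c1 == c2).
Definition is_zero (c1 k1 c2 k2 : nat) : bool := (k1 == k2.+1) && (c1 == c2.+1).

(* Value at r = 1 / t of rho (q ^ (c1 - c2) r ^ (k1 - k2)), after removal of a
   factor 1 / (1 - r t) in the first case and 1 - r t in the second. *)
Definition pair_weight (F : fieldType) (q t : F) c1 k1 c2 k2 : F :=
  if is_pole c1 k1 c2 k2 then (1 - q / t) * (1 - q^-1) / (1 - t^-1)
  else if is_zero c1 k1 c2 k2 then (1 - q ^+ 2 / t) / ((1 - q / t) * (1 - q))
  else rho q t (q ^+ c1 * t^-1 ^+ k1 / (q ^+ c2 * t^-1 ^+ k2)).

Lemma fmorph_pair_weight (F K : fieldType) (phi : {rmorphism F -> K})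
    (q t : F) c1 k1 c2 k2 :
  phi (pair_weight q t c1 k1 c2 k2) = pair_weight (phi q) (phi t) c1 k1 c2 k2.
Proof.
rewrite /pair_weight; case: ifP => _; last case: ifP => _.
- by rewrite !(fmorph_div, rmorphM, rmorphB, rmorph1, fmorphV).
- by rewrite !(fmorph_div, rmorphM, rmorphB, rmorph1, rmorphXn).
- by rewrite fmorph_rho !(fmorph_div, rmorphM, rmorphXn, fmorphV).
Qed.

Section Weights.
Variables (F : fieldType) (q t s : F).
Hypothesis ind : independent q t s.
Local Notation r := (indet F).
Local Notation tau := (1 - indet F * cst t).

Lemma ind_qt j k j' k' : q ^+ j * t ^+ k = q ^+ j' * t ^+ k' -> j = j' /\ k = k'.
Proof. by move=> E; have [|_ -> ->] := @ind 0%N j k 0%N j' k'; rewrite // !mul1r. Qed.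

Lemma ind_neq0 : [/\ q != 0, t != 0 & s != 0].
Proof.
split; apply/eqP => E0.
- by have [] := @ind 0%N 1%N 0%N 0%N 2%N 0%N; rewrite ?E0 ?expr0n /= ?mulr0 ?mul0r.
- by have [] := @ind 0%N 0%N 1%N 0%N 0%N 2%N; rewrite ?E0 ?expr0n /= ?mulr0 ?mul0r.
- by have [] := @ind 1%N 0%N 0%N 2%N 0%N 0%N; rewrite ?E0 ?expr0n /= ?mulr0 ?mul0r.
Qed.

Lemma ind_sub j k j' k' : (j != j') || (k != k') ->
  q ^+ j * t ^+ k - q ^+ j' * t ^+ k' != 0.
Proof.
move=> n; rewrite subr_eq0; apply: contraTneq n => /ind_qt[-> ->].
by rewrite !eqxx.
Qed.

(** The second hypothesis excludes the ratio 1 / q, a root of 1 - q v. Each remaining factor is, up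
    to a nonzero monomial, a difference of two distinct monomials. *)
Lemma pair_weight_neq0 c1 k1 c2 k2 : (c1, k1) != (c2, k2) ->
  ~~ ((k1 == k2) && (c2 == c1.+1)) -> pair_weight q t c1 k1 c2 k2 != 0.
Proof.
have [q0 t0 s0] := ind_neq0; move=> ne na.
have fix1 (x y : F) : y != 0 -> y - x != 0 -> 1 - x / y != 0.
  by move=> y0; apply: contraNneq => /(congr1 ( *%R^~ y));
     rewrite mul0r mulrBl mul1r divfK // => ->.
rewrite /pair_weight; case: ifP => [_|np]; last case: ifP => [_|nz].
- rewrite !mulf_neq0 ?invr_eq0 //.
  + by apply: fix1 => //; have := @ind_sub 0%N 1%N 1%N 0%N isT; rewrite mul1r mulr1.
  + rewrite -[q^-1]mul1r; apply: fix1 => //.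
    by have := @ind_sub 1%N 0%N 0%N 0%N isT; rewrite !mulr1.
  + rewrite -[t^-1]mul1r; apply: fix1 => //.
    by have := @ind_sub 0%N 1%N 0%N 0%N isT; rewrite !mul1r.
- rewrite !mulf_neq0 ?invr_eq0 ?mulf_neq0 //.
  + by apply: fix1 => //; have := @ind_sub 0%N 1%N 2%N 0%N isT; rewrite mul1r mulr1.
  + by apply: fix1 => //; have := @ind_sub 0%N 1%N 1%N 0%N isT; rewrite mul1r mulr1.
  + by have := @ind_sub 0%N 0%N 1%N 0%N isT; rewrite !mulr1.
have vE : q ^+ c1 * t^-1 ^+ k1 / (q ^+ c2 * t^-1 ^+ k2)
    = q ^+ c1 * t ^+ k2 / (q ^+ c2 * t ^+ k1).
  by rewrite !exprVn; field; rewrite !expf_neq0.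
have dn0 : q ^+ c2 * t ^+ k1 != 0 by rewrite mulf_neq0 ?expf_neq0.
rewrite vE /rho !mulf_neq0 ?invr_eq0 ?mulf_neq0 //.
- rewrite mulrA; apply: fix1 => //; rewrite mulrA -exprS; apply: ind_sub.
  by rewrite -negb_and andbC.
- rewrite mulrA -mulrA -invfM; apply: fix1; first by rewrite mulf_neq0.
  rewrite mulrCA -exprS mulrAC -exprSr; apply: ind_sub.
  rewrite -negb_and; apply/negP => /andP[/eqP e1 /eqP e2].
  by move/negbT: nz; rewrite /is_zero -e1 -e2 !eqxx.
- apply: fix1 => //; apply: ind_sub; rewrite -negb_and eq_sym.
  by apply: contra ne => /andP[/eqP-> /eqP->].
- rewrite mulrA; apply: fix1 => //; rewrite mulrCA -exprS; apply: ind_sub.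
  rewrite -negb_and; apply/negP => /andP[/eqP e1 /eqP e2].
  by move/negbT: np; rewrite /is_pole e1 e2 !eqxx.
Qed.

Lemma rho_value z v : has_value_at t^-1 z v -> 1 - v != 0 -> 1 - t * v != 0 ->
  has_value_at t^-1 (rho (cst q) (cst t) z) (rho q t v).
Proof.
have [q0 t0 s0] := ind_neq0; move=> hz n1 n2; have v1 := value1 t^-1.
have vq := value_cst t^-1 q; have vt := value_cst t^-1 t.
rewrite /rho; apply: value_div; first by rewrite mulf_neq0.
  apply: valueM; apply: valueB => //; first exact: valueM.
  by apply: value_div => //; apply: valueM.
by apply: valueM; apply: valueB => //; apply: valueM.
Qed.

Lemma tau_neq0 : tau != 0.
Proof.
have E1 : cst 1 = 1 :> ratfun F by exact: (rmorph1 (cst_morph F)).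
rewrite subr_eq0; apply/eqP => E.
have [] // := @cst_indet_inj F 1 t 0%N 1%N (oner_neq0 _).
by rewrite E1 mul1r expr0 mulrC.
Qed.

Lemma monomial_ratio (K : fieldType) (x y : K) c k : x != 0 -> y != 0 ->
  [/\ x ^+ c * y ^+ k.+1 / (x ^+ c * y ^+ k) = y,
      x ^+ c.+1 * y ^+ k.+1 / (x ^+ c * y ^+ k) = x * y
    & forall z, 1 - z * (x * y) / x = 1 - y * z].
Proof.
by move=> x0 y0; split=> [||z]; rewrite ?exprS; field; rewrite ?expf_neq0 ?x0.
Qed.

(** Keeping the powers of [tau] on both sides, with booleans as exponents, lets the identity be
    multiplied over all pairs, so that poles and zeros are merely counted. *)
Lemma rho_regularized c1 k1 c2 k2 : (c1, k1) != (c2, k2) ->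
  exists reg, 
    rho (cst q) (cst t) (cst q ^+ c1 * r ^+ k1 / (cst q ^+ c2 * r ^+ k2))
      * tau ^+ is_pole c1 k1 c2 k2 = tau ^+ is_zero c1 k1 c2 k2 * reg /\
    has_value_at t^-1 reg (pair_weight q t c1 k1 c2 k2).
Proof.
have [q0 t0 s0] := ind_neq0; move=> ne.
have fix1 (x y : F) : y != 0 -> y - x != 0 -> 1 - x / y != 0.
  by move=> y0; apply: contraNneq => /(congr1 ( *%R^~ y));
     rewrite mul0r mulrBl mul1r divfK // => ->.
have v1 := value1 t^-1; have vr := value_indet t^-1.
have vq := value_cst t^-1 q; have vt := value_cst t^-1 t.
have q0' : cst q != 0 by rewrite (fmorph_eq0 (cst_morph F)).
have t0' : cst t != 0 by rewrite (fmorph_eq0 (cst_morph F)).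
have r0' : r != 0 by rewrite tofrac_eq0 polyX_eq0.
have n1 : 1 - q / t != 0.
  by apply: fix1 => //; have := @ind_sub 0%N 1%N 1%N 0%N isT; rewrite mul1r mulr1.
have n2 : 1 - t^-1 != 0.
  rewrite -[t^-1]mul1r; apply: fix1 => //.
  by have := @ind_sub 0%N 1%N 0%N 0%N isT; rewrite !mul1r.
have n3 : 1 - q != 0 by have := @ind_sub 0%N 0%N 1%N 0%N isT; rewrite !mulr1.
rewrite /pair_weight; case: ifP => [ip|np]; last case: ifP => [iz|nz].
- case/andP: (ip) => /eqP -> /eqP ->; rewrite /is_pole /is_zero !eqxx (ltn_eqF (ltnSn _)) /=.
  have [-> _ _] := monomial_ratio c2 k2 q0' r0'.
  exists ((1 - cst q * r) * (1 - cst t * r / cst q) / (1 - r)); split.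
    rewrite expr0 mul1r expr1 /rho [r * cst t]mulrC invfM mulrA; apply: divfK.
    by rewrite mulrC tau_neq0.
  have -> : q^-1 = t * t^-1 / q by rewrite divff // mul1r.
  apply: value_div => //; last exact: valueB.
  apply: valueM; apply: valueB => //; first exact: valueM.
  by apply: value_div => //; apply: valueM.
- case/andP: (iz) => /eqP -> /eqP -> /=.
  rewrite expr0 mulr1 expr1.
  have [_ -> e0] := monomial_ratio c2 k2 q0' r0'.
  exists ((1 - cst q ^+ 2 * r) / ((1 - cst q * r) * (1 - cst t * (cst q * r)))); split.
    by rewrite /rho e0 expr2 !mulrA mulrAC [_ * tau]mulrC !mulrA.
  (* The right side is the form in which 1 - t (q r) is evaluated at r = 1 / t. *)
  have e2 : 1 - q = 1 - t * (q / t) by field.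
  rewrite e2 in n3 *.
  apply: value_div; first by rewrite mulf_neq0.
    by apply: valueB => //; apply: valueM => //; apply: valueX.
  by apply: valueM; apply: valueB => //; do ?apply: valueM.
eexists; split; first by rewrite /= !expr0 mulr1 mul1r.
have vE : q ^+ c1 * t^-1 ^+ k1 / (q ^+ c2 * t^-1 ^+ k2)
    = q ^+ c1 * t ^+ k2 / (q ^+ c2 * t ^+ k1).
  by rewrite !exprVn; field; rewrite !expf_neq0.
have dn0 : q ^+ c2 * t ^+ k1 != 0 by rewrite mulf_neq0 ?expf_neq0.
apply: rho_value.
- apply: value_div; first by rewrite mulf_neq0 ?expf_neq0 ?invr_eq0.
    by apply: valueM; apply: valueX.
  by apply: valueM; apply: valueX.
- rewrite vE; apply: fix1 => //; apply: ind_sub; rewrite -negb_and eq_sym.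
  by apply: contra ne => /andP[/eqP-> /eqP->].
- rewrite vE mulrA; apply: fix1 => //; rewrite mulrCA -exprS; apply: ind_sub.
  rewrite -negb_and; apply/negP => /andP[/eqP e1 /eqP e2].
  by move/negbT: np; rewrite /is_pole e1 e2 !eqxx.
Qed.
End Weights.

(** * Tableaux *)

Section Tableaux.
Local Open Scope nat_scope.
Variables (n : nat) (mu : 'X_{1..n}).
Hypothesis hmu : is_partition mu.
Local Notation square := (square mu).
Implicit Types (x y : square) (f : {ffun square -> 'I_n}).

Definition row_ord x : 'I_n := tag x.
Definition row_ix x : nat := row_ord x.
Definition col_ix x : nat := tagged x.

Lemma col_ix_lt x : col_ix x < mu (row_ord x).
Proof. exact: ltn_ord. Qed.

Lemma square_inj x y : row_ix x = row_ix y -> col_ix x = col_ix y -> x = y.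
Proof.
case: x y => [i a] [j b]; rewrite /row_ix /row_ord /col_ix /= => /val_inj E.
by subst j => /val_inj ->.
Qed.

Lemma square_ex (i : 'I_n) j : j < mu i -> exists x, row_ord x = i /\ col_ix x = j.
Proof. by move=> h; exists (Tagged (fun i => 'I_(mu i)) (Ordinal h)). Qed.

Lemma square_ex_row x i : i <= row_ix x -> exists y, row_ix y = i /\ col_ix y = col_ix x.
Proof.
move=> le; have lt : i < n by apply: leq_ltn_trans le (ltn_ord _).
have [|y [ty cy]] := @square_ex (Ordinal lt) (col_ix x).
  by apply: leq_trans (col_ix_lt x) _; apply: hmu.
by exists y; rewrite /row_ix ty.
Qed.

Lemma square_ex_col x j : j <= col_ix x -> exists y, row_ord y = row_ord x /\ col_ix y = j.
Proof. by move=> le; apply: square_ex; apply: leq_ltn_trans le (col_ix_lt x). Qed.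

(** The right neighbour; the default [x] occurs only at the end of a row. *)
Definition right x :=
  odflt x [pick y | (row_ix y == row_ix x) && (col_ix y == (col_ix x).+1)].

Lemma rightP x : (col_ix x).+1 < mu (row_ord x) ->
  row_ix (right x) = row_ix x /\ col_ix (right x) = (col_ix x).+1.
Proof.
move=> h; rewrite /right; case: pickP => [y /andP[/eqP ? /eqP ?] //|].
have [y [ty cy]] := square_ex h; move/(_ y).
by rewrite /row_ix ty cy !eqxx.
Qed.

(** With [col_strict], the reverse semistandard condition, stated for adjacent squares because these
    are the pairs where [rho] vanishes or has a pole. *)
Definition row_weak f := [forall x, forall y,
  (row_ix x == row_ix y) && (col_ix y == (col_ix x).+1) ==> (f y <= f x)].
Definition col_strict f := [forall x, forall y,
  (col_ix x == col_ix y) && (row_ix x == (row_ix y).+1) ==> (f x < f y)].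

Lemma row_weakP f : row_weak f ->
  forall x y, row_ix x = row_ix y -> col_ix x <= col_ix y -> f y <= f x.
Proof.
move=> rw x y; have [k ek] : {k | col_ix y - col_ix x = k} by eexists.
elim: k x ek => [|k IH] x ek rxy le.
  by rewrite (square_inj rxy) //; lia.
have [|z [tz cz]] := @square_ex_col y (col_ix x).+1; first by lia.
have rz : row_ix z = row_ix y by rewrite /row_ix tz.
apply: (@leq_trans (f z)); first by apply: IH; lia.
have /forallP/(_ x)/forallP/(_ z)/implyP := rw; apply.
by rewrite rxy rz cz !eqxx.
Qed.

Lemma col_strictP f : col_strict f ->
  forall x y, col_ix x = col_ix y -> row_ix x <= row_ix y ->
    f y + (row_ix y - row_ix x) <= f x.
Proof.
move=> cs x y; have [k ek] : {k | row_ix y - row_ix x = k} by eexists.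
elim: k x ek => [|k IH] x ek cxy le.
  by rewrite ek addn0 (@square_inj x y) //; lia.
have [|z [rz cz]] := @square_ex_row y (row_ix x).+1; first by lia.
have h : f y + (row_ix y - row_ix z) <= f z by apply: IH; lia.
have : f z < f x.
  have /forallP/(_ z)/forallP/(_ x)/implyP := cs; apply.
  by rewrite rz cz cxy !eqxx.
lia.
Qed.

(** Coordinates here start from 0; the shift by one to [sq_col] and [sq_row] does not affect
    [is_pole] and [is_zero]. *)
Definition square_pole (p : square * square) :=
  is_pole (col_ix p.1) (row_ix p.1) (col_ix p.2) (row_ix p.2).
Definition square_zero (p : square * square) :=
  is_zero (col_ix p.1) (row_ix p.1) (col_ix p.2) (row_ix p.2).

Definition poles f := #|[set p : square * square | (f p.1 < f p.2) && square_pole p]|.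
Definition zeros f := #|[set p : square * square | (f p.1 < f p.2) && square_zero p]|.

(** The lower square of a pole is never in the first row, which accounts for the predecessor. *)
Lemma card_lower_rows :
  #|[set i : 'I_n | (0 < i) && (0 < mu i)]| = (part_length mu).-1.
Proof.
rewrite /part_length; case: (posnP n) => [n0|n_gt0].
  rewrite !eq_card0 // => i; exfalso; have := ltn_ord i; lia.
pose o := Ordinal n_gt0.
have [m0|m0] := posnP (mu o).
  rewrite !eq_card0 // => i; have := @hmu o i (leq0n i); rewrite !inE; lia.
rewrite [in RHS](cardsD1 o) inE m0 /=; apply: eq_card => i.
by rewrite !inE lt0n.
Qed.

(* A pole off the end of its row injects into the zeros one column to the right,
   and a pole at the end of its row is determined by that row. *)
Lemma poles_zeros f : row_weak f ->
  poles f <= zeros f + (part_length mu).-1 /\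
  (poles f == zeros f + (part_length mu).-1) = col_strict f.
Proof.
move=> rw; have rwP := row_weakP rw.
pose PS := [set p : square * square | (f p.1 < f p.2) && square_pole p].
pose ZS := [set p : square * square | (f p.1 < f p.2) && square_zero p].
pose last (p : square * square) := ~~ ((col_ix p.1).+1 < mu (row_ord p.1)).
pose P1 := [set p in PS | ~~ last p]; pose P2 := [set p in PS | last p].
pose RS := [set i : 'I_n | (0 < i) && (0 < mu i)].
pose phi (p : square * square) := (right p.1, p.2).
pose psi (p : square * square) := row_ord p.1.
have psE x y : (x, y) \in PS ->
    [/\ f x < f y, row_ix x = (row_ix y).+1 & col_ix x = col_ix y].
  by rewrite inE => /and3P[-> /eqP -> /eqP ->].
have P1E x y : (x, y) \in P1 -> [/\ (x, y) \in PS, row_ix (right x) = row_ix x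
    & col_ix (right x) = (col_ix x).+1].
  by rewrite inE negbK => /andP[-> /rightP[-> ->]].
have P2E x y : (x, y) \in P2 -> (x, y) \in PS /\ (col_ix x).+1 = mu (row_ord x).
  rewrite inE => /andP[-> h]; split=> //.
  by have := col_ix_lt x; rewrite /last /= in h; lia.
have phi_inj : {in P1 &, injective phi}.
  move=> [x y] [x' y'] /P1E[_ r1 c1] /P1E[_ r2 c2] [/= e1 <-].
  by rewrite e1 in r1 c1; congr (_, _); apply: square_inj; lia.
have psi_inj : {in P2 &, injective psi}.
  move=> [x y] [x' y'] /P2E[/psE[_ r1 c1] e1] /P2E[/psE[_ r2 c2] e2].
  rewrite /psi /= => E; rewrite E -e2 in e1.
  have rE : row_ix x = row_ix x' by rewrite /row_ix E.
  by congr (_, _); apply: square_inj; lia.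
have phiS : phi @: P1 \subset ZS.
  apply/subsetP => _ /imsetP[[x y] /P1E[/psE[lt r c] r' c'] ->].
  rewrite inE /= /square_zero /is_zero /= r' c' r c !eqxx !andbT.
  by apply: leq_ltn_trans lt; apply: rwP; lia.
have psiS : psi @: P2 \subset RS.
  apply/subsetP => _ /imsetP[[x y] /P2E[/psE[lt r c] e] ->]; rewrite inE.
  by rewrite /psi /= -e andbT -/(row_ix x) r.
have cP : poles f = #|phi @: P1| + #|psi @: P2|.
  rewrite !card_in_imset // /poles -/PS -(cardsID [set p | last p] PS) addnC.
  by congr (_ + _); apply: eq_card => p; rewrite !inE // andbC.
rewrite cP /zeros -/ZS -card_lower_rows -/RS.
have le1 := subset_leq_card phiS; have le2 := subset_leq_card psiS.
split; first exact: leq_add.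
apply/idP/idP => [/eqP E|cs].
  have e1 : phi @: P1 = ZS by apply/eqP; rewrite eqEcard phiS; lia.
  have e2 : psi @: P2 = RS by apply/eqP; rewrite eqEcard psiS; lia.
  apply/forallP => x; apply/forallP => y; apply/implyP => /andP[/eqP c /eqP r].
  (* Induction leftwards from the end of the row. At the end, surjectivity of [psi] supplies the
     pole. Elsewhere, strictness one column to the right makes [(right x, y)] a zero, and
     surjectivity of [phi] turns it back into the pole [(x, y)]. *)
  have [k ek] : {k | mu (row_ord x) - col_ix x = k} by eexists.
  elim: k x y c r ek => [|k IH] x y c r ek; first by have := col_ix_lt x; lia.
  have [e|lt] := eqVneq (col_ix x).+1 (mu (row_ord x)).
    have : row_ord x \in RS by rewrite inE -e andbT -/(row_ix x) r.
    rewrite -e2 => /imsetP[[z w] /P2E[/psE[lt r1 c1] e']]; rewrite /psi /= => tE.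
    have rE : row_ix x = row_ix z by rewrite /row_ix tE.
    rewrite tE -e' in e.
    have -> : x = z by apply: square_inj; lia.
    by have -> : y = w by apply: square_inj; lia.
  have lt' : (col_ix x).+1 < mu (row_ord x) by have := col_ix_lt x; lia.
  have [rr cr] := rightP lt'.
  have tr : row_ord (right x) = row_ord x by apply: val_inj.
  have [|y' [ry' cy']] := @square_ex_row (right x) (row_ix y); first by lia.
  have IHr : f (right x) < f y' by apply: IH; rewrite ?tr; lia.
  have : (right x, y) \in ZS.
    rewrite inE /= /square_zero /is_zero /= rr cr r c !eqxx !andbT.
    by apply: leq_trans IHr _; apply: rwP; lia.
  rewrite -e1 => /imsetP[[z w] /P1E[/psE[lt1 r1 c1] r2 c2] [eR eY]].
  rewrite -eR in r2 c2; rewrite -eY in r1 c1 lt1.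
  by have -> : x = z by apply: square_inj; lia.
(* Conversely, strict columns make every vertically adjacent pair a pole, so both injections are
   onto. *)
have csP := col_strictP cs.
have -> : phi @: P1 = ZS.
  apply/eqP; rewrite eqEsubset phiS; apply/subsetP => -[x y].
  rewrite inE /= /square_zero /is_zero /= => /and3P[lt /eqP r /eqP c].
  have [|z [tz cz]] := @square_ex_col x (col_ix y); first by lia.
  have rz : row_ix z = row_ix x by rewrite /row_ix tz.
  have ltz : (col_ix z).+1 < mu (row_ord z) by rewrite tz cz -c col_ix_lt.
  have [rr cr] := rightP ltz.
  apply/imsetP; exists (z, y); last first.
    by congr (_, _); apply: square_inj; rewrite /=; lia.
  rewrite !inE /= /last /= negbK ltz andbT /square_pole /is_pole /= cz rz r !eqxx !andbT.
  by apply: leq_trans (csP y z _ _); rewrite ?rz ?r ?subSnn ?addn1 ?cz.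
have -> : psi @: P2 = RS.
  apply/eqP; rewrite eqEsubset psiS; apply/subsetP => i; rewrite inE => /andP[i0 mi].
  have [|x [tx cx]] := @square_ex i (mu i).-1; first by lia.
  have rx : row_ix x = i by rewrite /row_ix tx.
  have [|y [ry cy]] := @square_ex_row x (row_ix x).-1; first by lia.
  apply/imsetP; exists (x, y); last by rewrite /psi tx.
  rewrite !inE /= /last /= tx cx prednK // ltnn andbT /square_pole /is_pole /= ry cy cx.
  rewrite rx prednK // !eqxx !andbT.
  have e : row_ix x - row_ix y = 1 by lia.
  by apply: leq_trans (csP y x _ _); rewrite ?e ?addn1 //; lia.
exact: eqxx.
Qed.

End Tableaux.

(** * The least reverse tableau, contents and containment *)

Section MinimalTableau.
Local Open Scope nat_scope.
Variables (n : nat) (mu : 'X_{1..n}).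
Hypothesis hmu : is_partition mu.
Local Notation square := (square mu).
Implicit Types (x y : square) (f : {ffun square -> 'I_n}).

Definition entry f x : nat := f x.

Lemma entry_col f : col_strict f -> forall x y, col_ix x = col_ix y ->
  row_ix x <= row_ix y -> entry f y + (row_ix y - row_ix x) <= entry f x.
Proof. exact: col_strictP. Qed.

(** The length of the column [j], that is, the part of the conjugate partition with index [j]
    counted from 0. *)
Definition conj_part j := \max_(i < n | j < mu i) i.+1.

Lemma lt_conj_part (i : 'I_n) j : (i < conj_part j) = (j < mu i).
Proof.
apply/idP/idP => [|h]; last exact: (@leq_bigmax_cond _ _ (fun i : 'I_n => i.+1)).
apply: contraTT; rewrite -!leqNgt => h; apply/bigmax_leqP => i' h'.
rewrite ltnNge; apply/negP => le; have := hmu le; lia.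
Qed.

Lemma conj_part_le j : conj_part j <= n.
Proof. by apply/bigmax_leqP => i _; exact: ltn_ord. Qed.

Lemma row_ix_lt_conj x : row_ix x < conj_part (col_ix x).
Proof. by rewrite lt_conj_part col_ix_lt. Qed.

(* The reflection (i, j) -> (conj_part j - 1 - i, j) of the columns. It is an
   involution, so the tableau row o flip has the same content as row, namely mu. *)
Definition flip x := odflt x
  [pick y | (col_ix y == col_ix x) && (row_ix y + row_ix x + 1 == conj_part (col_ix x))].

Lemma flipP x : col_ix (flip x) = col_ix x /\
  row_ix (flip x) + row_ix x + 1 = conj_part (col_ix x).
Proof.
rewrite /flip; case: pickP => [y /andP[/eqP ? /eqP ?] //|].
have lt := row_ix_lt_conj x; have le := conj_part_le (col_ix x).
have hi : conj_part (col_ix x) - row_ix x - 1 < n by lia.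
have [|y [ty cy]] := @square_ex _ mu (Ordinal hi) (col_ix x).
  by rewrite -lt_conj_part /=; lia.
have ry : row_ix y = conj_part (col_ix x) - row_ix x - 1 by rewrite {1}/row_ix ty.
by move/(_ y); rewrite cy eqxx /= => /eqP[]; lia.
Qed.

Lemma flipK : involutive flip.
Proof.
move=> x; have [c1 r1] := flipP x; have [c2 r2] := flipP (flip x).
by apply: square_inj; rewrite ?c2 // c1 in r2 *; lia.
Qed.

Definition min_tableau := [ffun x => row_ord (flip x)].

Lemma entry_min x : entry min_tableau x = row_ix (flip x).
Proof. by rewrite /entry ffunE. Qed.

Lemma min_tableau_col : col_strict min_tableau.
Proof.
apply/forallP => x; apply/forallP => y; apply/implyP => /andP[/eqP c /eqP r].
rewrite -![nat_of_ord _]/(entry _ _) !entry_min.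
by have [_ r1] := flipP x; have [_ r2] := flipP y; rewrite c in r1; lia.
Qed.

Lemma min_tableau_row : row_weak min_tableau.
Proof.
apply/forallP => x; apply/forallP => y; apply/implyP => /andP[/eqP r /eqP c].
rewrite -![nat_of_ord _]/(entry _ _) !entry_min.
have [_ r1] := flipP x; have [_ r2] := flipP y; rewrite c in r2.
suff : conj_part (col_ix x).+1 <= conj_part (col_ix x) by lia.
apply/bigmax_leqP => i h; rewrite lt_conj_part; lia.
Qed.

(** The bottom entry of a column is at least 0, and entries grow by at least one with each row
    upwards. *)
Lemma min_tableau_le f x : col_strict f -> entry min_tableau x <= entry f x.
Proof.
move=> cs; rewrite entry_min; have [c1 r1] := flipP x.
have lt := row_ix_lt_conj x; have le := conj_part_le (col_ix x).
have hi : conj_part (col_ix x) - 1 < n by lia.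
have [|y [ty cy]] := @square_ex _ mu (Ordinal hi) (col_ix x).
  by rewrite -lt_conj_part /=; lia.
have ry : row_ix y = conj_part (col_ix x) - 1 by rewrite /row_ix ty.
have := entry_col cs (esym cy); lia.
Qed.

Definition content f : 'X_{1..n} := (\sum_x U_(f x))%MM.

Lemma contentE f i : content f i = \sum_x (f x == i).
Proof. by rewrite /content mnm_sumE; apply: eq_bigr => x _; rewrite mnm1E. Qed.

Lemma mdeg_content f : mdeg (content f) = #|{: square}|.
Proof. by rewrite mdeg_sum (eq_bigr (fun=> 1)) ?sum1_card // => x _; rewrite mdeg1. Qed.

Lemma content_min : content min_tableau = mu.
Proof.
apply/mnmP => i; rewrite contentE (reindex_inj (inv_inj flipK)) /=.
under eq_bigr do rewrite ffunE flipK.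
have := @sig_big_dep _ _ addn _ (fun i => 'I_(mu i)) xpredT (fun _ => xpredT)
  (fun j (_ : 'I_(mu j)) => nat_of_bool (j == i)).
rewrite /= => <-; rewrite (bigD1 i) //= [X in _ + X]big1 ?addn0 => [|j /negPf ne].
  by rewrite eqxx big_const_ord iter_addn addn0 mul1n.
by rewrite ne big1.
Qed.

Lemma sum_content (P : pred 'I_n) f :
  \sum_(i | P i) content f i = \sum_x P (f x).
Proof.
under eq_bigr do rewrite contentE.
rewrite exchange_big /=; apply: eq_bigr => x _.
have [h|h] := boolP (P (f x)).
  rewrite (bigD1 (f x)) //= eqxx big1 // => i /andP[_]; rewrite eq_sym.
  by move/negPf ->.
by rewrite big1 // => i Pi; apply/eqP; rewrite eqb0; apply: contraNneq h => ->.
Qed.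

(** Larger entries leave fewer of them below any bound, so the partial sums of the content can only
    drop. For equal degrees the first differing index decides the monomial order. *)
Lemma content_le f : (forall x, entry min_tableau x <= entry f x) ->
  (content f <= mu)%O.
Proof.
move=> le; rewrite leNgt; apply/negP.
have dE : mdeg mu = mdeg (content f) by rewrite -{1}content_min !mdeg_content.
case/(ltmcP dE) => i eqj lti.
have h g : \sum_(j : 'I_n | j <= i) content g j = \sum_x (entry g x <= i).
  exact: sum_content.
have : \sum_(j : 'I_n | j <= i) content f j <= \sum_(j : 'I_n | j <= i) mu j.
  rewrite -content_min !h; apply: leq_sum => x _; have := le x.
  by case: (leqP (entry f x) i) => // h1 h2; rewrite (leq_trans h2 h1).
rewrite leqNgt (bigD1 i) //= [X in _ < X](bigD1 i) //=.
rewrite (eq_bigr (fun j => content f j)) ?ltn_add2r ?lti // => j /andP[le1 ne].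
by apply: eqj; rewrite ltn_neqAle ne.
Qed.

(** If the entry at [x] were larger, fewer entries of [f] than of [min_tableau] would be at most
    [entry min_tableau x], against the equality of contents. *)
Lemma content_min_unique f : (forall x, entry min_tableau x <= entry f x) ->
  content f = mu -> f = min_tableau.
Proof.
move=> le E; apply/ffunP => x; apply/val_inj/eqP.
rewrite -[val _]/(entry _ _) -[val (min_tableau x)]/(entry _ _) eqn_leq le andbT.
have h g : \sum_(j : 'I_n | j <= entry min_tableau x) content g j
   = \sum_y (entry g y <= entry min_tableau x).
  exact: sum_content.
have := h f; rewrite (eq_bigr (content min_tableau)); last by rewrite E content_min.
rewrite h => S.
rewrite leqNgt; apply/negP => lt; move/eqP: S; apply/negP; rewrite neq_ltn.
apply/orP; right; rewrite (bigD1 x) //= [X in _ < X](bigD1 x) //= leqnn.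
have -> : (entry f x <= entry min_tableau x) = false by rewrite leqNgt lt.
rewrite add0n add1n ltnS; apply: leq_sum => y _.
case: (leqP (entry f y) (entry min_tableau x)) => // h1.
by rewrite (leq_trans (le y) h1).
Qed.

(** Along the first row [f] decreases, so [nu (f x)] increases weakly; never equal to the column
    index, it stays above it. *)
Lemma tableau_nonvanishing f (nu : 'X_{1..n}) : row_weak f -> col_strict f ->
  is_partition nu -> (forall x, row_ix x = 0 -> nu (f x) <> col_ix x) ->
  forall x, row_ix x = 0 -> col_ix x < nu (f x).
Proof.
move=> rw cs hnu ne x; have [c ec] : {c | col_ix x = c} by eexists.
elim: c x ec => [|c IH] x ec rx; have := ne x rx; first by lia.
have [|y [ty cy]] := @square_ex_col _ mu x c; first by lia.
have ry : row_ix y = row_ix x by rewrite /row_ix ty.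
have h := IH y cy (etrans ry rx).
have : nu (f y) <= nu (f x) by apply: hnu; apply: row_weakP => //; lia.
lia.
Qed.

(** Above the last square of row [i], the entry in the first row is at least [i]; the bound on [nu]
    there passes to [nu i] by monotonicity. *)
Lemma tableau_contained f (nu : 'X_{1..n}) : row_weak f -> col_strict f ->
  is_partition nu -> (forall x, row_ix x = 0 -> nu (f x) <> col_ix x) ->
  (mu <= nu)%MM.
Proof.
move=> rw cs hnu ne; have h := tableau_nonvanishing rw cs hnu ne.
apply/mnm_lepP => i; have [->//|m0] := posnP (mu i).
have [|x [tx cx]] := @square_ex _ mu i (mu i).-1; first by lia.
have rx : row_ix x = i by rewrite /row_ix tx.
have [//|y [ry cy]] := @square_ex_row _ mu hmu x 0.
have := h y ry; have := entry_col cs cy; rewrite ry => /(_ isT) le1 lt.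
have : nu (f y) <= nu i by apply: hnu; rewrite -rx; move: le1; rewrite /entry; lia.
lia.
Qed.

(** For [nu] equal to [mu] the bound says that each top entry is less than the column length;
    strictness then pushes the whole column down to the least tableau. *)
Lemma tableau_diagonal f : row_weak f -> col_strict f ->
  (forall x, row_ix x = 0 -> mu (f x) <> col_ix x) -> f = min_tableau.
Proof.
move=> rw cs ne; have h := tableau_nonvanishing rw cs hmu ne.
apply/ffunP => x; apply/val_inj/eqP.
rewrite -[val _]/(entry _ _) -[val (min_tableau x)]/(entry _ _) eqn_leq.
rewrite min_tableau_le // andbT entry_min; have [_ r1] := flipP x.
have [//|y [ry cy]] := @square_ex_row _ mu hmu x 0.
have := h y ry; rewrite -lt_conj_part -[nat_of_ord _]/(entry f y) cy => lt.
have := entry_col cs cy; rewrite ry => /(_ isT) le1; lia.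
Qed.

End MinimalTableau.

(** * The limit polynomial *)

(** The limit of the normalized coefficient of the term [f]. It is 0 off the reverse tableaux, where
    a factor [rho] vanishes or the pole order is too small. *)
Definition tableau_weight (F : fieldType) n (mu : 'X_{1..n}) (q t : F)
    (f : {ffun square mu -> 'I_n}) : F :=
  if row_weak f && col_strict f then
    \prod_(p : square mu * square mu | (f p.1 < f p.2)%N)
      pair_weight q t (sq_col p.1) (sq_row p.1) (sq_col p.2) (sq_row p.2)
  else 0.

Lemma fmorph_tableau_weight (F K : fieldType) (phi : {rmorphism F -> K})
    n (mu : 'X_{1..n}) (q t : F) (f : {ffun square mu -> 'I_n}) :
  phi (tableau_weight q t f) = tableau_weight (phi q) (phi t) f.
Proof.
rewrite /tableau_weight; case: ifP => _; last exact: rmorph0.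
by rewrite rmorph_prod; apply: eq_bigr => p _; exact: fmorph_pair_weight.
Qed.

Definition linear_factors (F : fieldType) n (mu : 'X_{1..n}) (t : F)
    (u : square mu -> F) (f : square mu -> 'I_n) : {mpoly F[n]} :=
  \prod_x ('X_(f x) + (u x / t ^+ (f x).+1 + t ^+ (f x).+1 / u x)%:MP).

Definition limit_macdonald (F : fieldType) n (q t s : F) (mu : 'X_{1..n}) :
    {mpoly F[n]} :=
  \sum_(f : {ffun square mu -> 'I_n}) tableau_weight q t f *:
    linear_factors t (fun x => - s * q ^+ sq_col x * t^-1 ^+ sq_row x) f.

Lemma prod_linear (R : fieldType) n (I : Type) (r : seq I) (f : I -> 'I_n)
    (c : I -> R) : exists Q : {mpoly R[n]},
  \prod_(x <- r) ('X_(f x) + (c x)%:MP) = 'X_[(\sum_(x <- r) U_(f x))%MM] + Q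
  /\ (msize Q <= size r)%N.
Proof.
elim: r => [|x r [Q [E sQ]]].
  by exists 0; rewrite !big_nil mpolyX0 addr0 msize0.
exists ('X_(f x) * Q + (c x)%:MP * ('X_[(\sum_(x <- r) U_(f x))%MM] + Q)).
rewrite !big_cons E; split; first by rewrite mulrDl mulrDr -mpolyXD addrA.
have sX : (msize ('X_[(\sum_(x <- r) U_(f x))%MM] + Q) <= (size r).+1)%N.
  rewrite (leq_trans (msizeD_le _ _)) // geq_max msizeX (leq_trans sQ) // andbT.
  rewrite mdeg_sum ltnS; under eq_bigr do rewrite mdeg1.
  by rewrite sum1_size.
rewrite (leq_trans (msizeD_le _ _)) // geq_max; apply/andP; split.
  have [->|Q0] := eqVneq Q 0; first by rewrite mulr0 msize0.
  by rewrite msizeM // -?msize_poly_eq0 msizeX mdeg1.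
by rewrite mul_mpolyC (leq_trans (mmeasureZ_le _ _ _)).
Qed.

Lemma divf_cancel (K : fieldType) (a x y x' y' : K) : a != 0 ->
  a * x * y / (a * x' * y') = x * y / (x' * y').
Proof.
move=> a0; rewrite -[a * x * y]mulrA -[a * x' * y']mulrA -mulf_div.
by rewrite divff // mul1r.
Qed.

Definition qtsr_value (K : fieldType) n (mu : 'X_{1..n}) (q s r : K)
    (x : square mu) : K := - s * q ^+ sq_col x * r ^+ sq_row x.

Lemma qtsr_ratio (K : fieldType) n (mu : 'X_{1..n}) (q s r : K) (x y : square mu) :
  s != 0 -> qtsr_value q s r x / qtsr_value q s r y =
  q ^+ sq_col x * r ^+ sq_row x / (q ^+ sq_col y * r ^+ sq_row y).
Proof.
by move=> s0; apply: (@divf_cancel _ (- s)); rewrite oppr_eq0.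
Qed.

Lemma qtsr_value_neq0 (K : fieldType) n (mu : 'X_{1..n}) (q s r : K) (x : square mu) :
  q != 0 -> s != 0 -> r != 0 -> qtsr_value q s r x != 0.
Proof. by move=> q0 s0 r0; rewrite !mulf_neq0 ?expf_neq0 ?oppr_eq0. Qed.

Lemma rho_row_adjacent (K : fieldType) (q t y : K) c k : q != 0 -> y != 0 ->
  rho q t (q ^+ c * y ^+ k / (q ^+ c.+1 * y ^+ k)) = 0.
Proof.
move=> q0 y0; have -> : q ^+ c * y ^+ k / (q ^+ c.+1 * y ^+ k) = q^-1.
  by rewrite exprS; field; rewrite q0 !expf_neq0.
by rewrite /rho divff // subrr !mul0r.
Qed.

Lemma mdeg_square n (mu : 'X_{1..n}) : is_partition mu -> mdeg mu = #|{: square mu}|.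
Proof.
by move=> hmu; rewrite -[mdeg mu](congr1 mdeg (content_min hmu)) mdeg_content.
Qed.

Lemma size_squares n (mu : 'X_{1..n}) : size (index_enum (square mu)) = #|{: square mu}|.
Proof. by rewrite -sum1_size sum1_card. Qed.

Lemma symmetricZ (R : comNzRingType) n c (P : {mpoly R[n]}) :
  P \is symmetric -> c *: P \is symmetric.
Proof. exact: rpredZ. Qed.

Section LimitMacdonald.
Variables (F : fieldType) (q t s : F) (n : nat).
Hypothesis ind : independent q t s.
Implicit Types (mu nu : 'X_{1..n}).
Local Notation r := (indet F).
Local Notation tau := (1 - indet F * cst t).
Local Notation L mu := (limit_macdonald q t s mu).

Let q0 : q != 0. Proof. by case: (ind_neq0 ind). Qed.
Let t0 : t != 0. Proof. by case: (ind_neq0 ind). Qed.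
Let s0 : s != 0. Proof. by case: (ind_neq0 ind). Qed.
Let cq0 : cst q != 0. Proof. by rewrite (fmorph_eq0 (cst_morph F)). Qed.
Let ct0 : cst t != 0. Proof. by rewrite (fmorph_eq0 (cst_morph F)). Qed.
Let cs0 : cst s != 0. Proof. by rewrite (fmorph_eq0 (cst_morph F)). Qed.
Let r0 : r != 0. Proof. by rewrite tofrac_eq0 polyX_eq0. Qed.

Local Notation U := (qtsr_value (cst q) (cst s) r).

(** Multiplying [rho_regularized] over all pairs leaves a regular product times a power of [tau]. By
    [poles_zeros] the exponent is nonnegative, and it is zero exactly for strict columns. *)
Lemma tableau_weight_value mu (f : {ffun square mu -> 'I_n}) :
  is_partition mu ->
  has_value_at t^-1 (tau ^+ (part_length mu).-1 *
    \prod_(p : square mu * square mu | (f p.1 < f p.2)%N)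
      rho (cst q) (cst t) (U p.1 / U p.2))
  (tableau_weight q t f).
Proof.
move=> hmu; rewrite /tableau_weight; have [rw|nrw] /= := boolP (row_weak f); last first.
  (* An ascent between row neighbours contributes the factor [rho] at 1 / q, which is 0. *)
  move: nrw; rewrite negb_forall => /existsP[x]; rewrite negb_forall => /existsP[y].
  rewrite negb_imply -ltnNge => /andP[/andP[/eqP rE /eqP cE] lt].
  rewrite [X in _ * X](_ : _ = 0) ?mulr0; first exact: value0.
  apply/eqP; rewrite prodf_seq_eq0; apply/hasP; exists (x, y).
    exact: mem_index_enum.
  rewrite lt qtsr_ratio // /sq_col /sq_row /=.
  have -> : (tag x : nat) = tag y by exact: rE.
  have -> : (tagged y : nat) = (tagged x).+1 by exact: cE.
  by apply/eqP; exact: (rho_row_adjacent _ _ _ cq0 r0).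
have ne (p : square mu * square mu) : (f p.1 < f p.2)%N ->
    (sq_col p.1, sq_row p.1) != (sq_col p.2, sq_row p.2).
  move=> lt; apply: contraTneq lt => -[cE rE]; rewrite -leqNgt.
  by rewrite (@square_inj _ _ p.1 p.2 rE cE).
have /fin_all_exists[reg regP] : forall p : square mu * square mu,
    exists reg : ratfun F, (f p.1 < f p.2)%N ->
    rho (cst q) (cst t) (U p.1 / U p.2) * tau ^+ square_pole p
      = tau ^+ square_zero p * reg /\
    has_value_at t^-1 reg
      (pair_weight q t (sq_col p.1) (sq_row p.1) (sq_col p.2) (sq_row p.2)).
  move=> p; have [lt|] := boolP (f p.1 < f p.2)%N; last by exists 0.
  have [reg regP] := rho_regularized ind (ne p lt).
  by exists reg => _; rewrite qtsr_ratio.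
have tpow (b : square mu * square mu -> bool) :
    \prod_(p : square mu * square mu | (f p.1 < f p.2)%N) tau ^+ b p
    = tau ^+ #|[set p : square mu * square mu | (f p.1 < f p.2)%N && b p]|.
  rewrite prodrXr; congr (_ ^+ _).
  rewrite -sum1dep_card big_mkcondr /=; apply: eq_bigr => p _.
  by case: (b p).
have E : (\prod_(p : square mu * square mu | (f p.1 < f p.2)%N)
      rho (cst q) (cst t) (U p.1 / U p.2)) * tau ^+ poles f
   = tau ^+ zeros f * \prod_(p | (f p.1 < f p.2)%N) reg p.
  rewrite /poles /zeros -!tpow -!big_split; apply: eq_bigr => p lt.
  by have [] := regP p lt.
have tau0 := tau_neq0 t.
have [le eq] := poles_zeros hmu rw.
have -> : tau ^+ (part_length mu).-1 * \prod_(p | (f p.1 < f p.2)%N)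
      rho (cst q) (cst t) (U p.1 / U p.2)
   = tau ^+ (zeros f + (part_length mu).-1 - poles f) *
     \prod_(p | (f p.1 < f p.2)%N) reg p.
  apply: (mulIf (expf_neq0 (poles f) tau0)).
  rewrite -mulrA E mulrA -exprD mulrAC -exprD subnK //.
  by rewrite addnC.
have vtau : has_value_at t^-1 tau 0.
  have -> : 0 = 1 - t^-1 * t :> F by rewrite mulVf // subrr.
  apply: valueB; first exact: value1.
  by apply: valueM; [exact: value_indet|exact: value_cst].
have vreg : has_value_at t^-1 (\prod_(p | (f p.1 < f p.2)%N) reg p)
  (\prod_(p | (f p.1 < f p.2)%N)
     pair_weight q t (sq_col p.1) (sq_row p.1) (sq_col p.2) (sq_row p.2)).
  by apply: value_prod => p lt; have [] := regP p lt.
case: ifP => cs.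
  by move: eq; rewrite cs => /eqP ->; rewrite subnn expr0 mul1r.
have := valueM (valueX (zeros f + (part_length mu).-1 - poles f) vtau) vreg.
rewrite expr0n subn_eq0 (_ : (_ <= _)%N = false) ?mul0r //.
by apply/negbTE; rewrite -ltnNge ltn_neqAle eq cs le.
Qed.

(** The only pair with weight zero is a square with its right neighbour, and [row_weak] excludes an
    ascent there. *)
Lemma tableau_weight_neq0 mu (f : {ffun square mu -> 'I_n}) :
  row_weak f -> col_strict f -> tableau_weight q t f != 0.
Proof.
move=> rw cs; rewrite /tableau_weight rw cs /=; apply/prodf_neq0 => -[x y] /= lt.
have ne : (sq_col x, sq_row x) != (sq_col y, sq_row y).
  apply: contraTneq lt => -[cE rE]; rewrite -leqNgt.
  by rewrite (@square_inj _ _ x y rE cE).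
apply: (pair_weight_neq0 ind ne).
apply/negP => /andP[/eqP[rE] /eqP[cE]]; move: lt; apply/negP; rewrite -leqNgt.
by apply: row_weakP rE _ => //; rewrite /col_ix cE leqnSn.
Qed.

Lemma limit_macdonaldP mu : is_partition mu ->
  mpoly_limit t^-1 (tau ^+ (part_length mu).-1 *:
    macdonald_qtsr mu (cst q) (cst t) (cst s) r) (L mu).
Proof.
move=> hmu; rewrite /macdonald_qtsr /generic_macdonald scaler_sumr.
apply: limit_sum => f _; rewrite scalerA; apply: limitZ.
  exact: tableau_weight_value.
apply: limit_prod => x _; apply: limitD; first exact: limit_mon.
apply: limitC.
have vu : has_value_at t^-1 (U x) (- s * q ^+ sq_col x * t^-1 ^+ sq_row x).
  apply: valueM; last by apply: valueX; exact: value_indet.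
  by apply: valueM; [apply: valueN|apply: valueX]; exact: value_cst.
have vt : has_value_at t^-1 (cst t ^+ (f x).+1) (t ^+ (f x).+1).
  by apply: valueX; exact: value_cst.
apply: valueD; apply: value_div => //; first by rewrite expf_neq0.
by rewrite !mulf_neq0 ?expf_neq0 ?oppr_eq0 ?invr_eq0.
Qed.

(** Distinct squares differ in the exponent of q or r, which a power of t cannot compensate. The
    cases [e] = 0, 1, 2 are the genericity conditions for symmetry. *)
Lemma qtsr_value_generic mu (x y : square mu) e : x != y ->
  U x != cst t ^+ e * U y.
Proof.
move=> /eqP ne; have UE z : U z = cst (- s * q ^+ sq_col z) * r ^+ sq_row z.
  by rewrite /qtsr_value -![cst _]/(cst_morph F _) rmorphM rmorphN rmorphXn.
have -> : cst t ^+ e * U y = cst (t ^+ e * (- s * q ^+ sq_col y)) * r ^+ sq_row y.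
  rewrite UE mulrA; congr (_ * _).
  by rewrite -![cst _]/(cst_morph F _) [in RHS]rmorphM rmorphXn.
rewrite UE; apply/eqP => /cst_indet_inj[].
  by rewrite mulf_neq0 ?oppr_eq0 ?expf_neq0.
move=> rE; rewrite mulrCA !mulNr => /oppr_inj /esym E.
have [] := @ind 1%N (sq_col y) e 1%N (sq_col x) 0%N.
  by rewrite !expr1 expr0 mulr1 -E -mulrA [q ^+ _ * _]mulrC.
by move=> _ cE _; apply: ne; apply: square_inj; [case: rE|case: cE].
Qed.

(** Symmetry is obtained for indeterminate r and passed to the limit: at r = 1 / t vertically
    adjacent squares would violate genericity. *)
Lemma limit_macdonald_symmetric mu : is_partition mu -> L mu \is symmetric.
Proof.
move=> hmu; apply: limit_symmetric (limit_macdonaldP hmu) _.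
have t1 k : t ^+ k.+1 != 1.
  by have := @ind_sub _ _ _ _ ind 0%N k.+1 0%N 0%N isT; rewrite !mul1r subr_eq0.
apply: symmetricZ; apply: generic_macdonald_symmetric.
- exact: cq0.
- exact: ct0.
- by have := t1 0%N; rewrite -(fmorph_eq1 (cst_morph F)).
- by have := t1 1%N; rewrite -(fmorph_eq1 (cst_morph F)) rmorphXn.
- by move=> x; apply: (qtsr_value_neq0 x cq0 cs0 r0).
- move=> x y ne; split; last exact: qtsr_value_generic ne.
    have e0 := qtsr_value_generic 0 ne; rewrite expr0 in e0.
    by rewrite mul1r in e0.
  have e1 := qtsr_value_generic 1 ne.
  by rewrite expr1 in e1.
Qed.

Lemma mcoeff_limit_macdonald mu m : is_partition mu -> mdeg m = mdeg mu ->
  (L mu)@_m = \sum_(f : {ffun square mu -> 'I_n} | content f == m)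
     tableau_weight q t f.
Proof.
move=> hmu dm; rewrite /limit_macdonald raddf_sum [RHS]big_mkcond /=.
apply: eq_bigr => f _; rewrite mcoeffZ /linear_factors.
have [Q [-> sQ]] := prod_linear (index_enum (square mu)) f
  (fun x => - s * q ^+ sq_col x * t^-1 ^+ sq_row x / t ^+ (f x).+1
   + t ^+ (f x).+1 / (- s * q ^+ sq_col x * t^-1 ^+ sq_row x)).
rewrite mcoeffD mcoeffX -/(content f) [Q@_m](_ : _ = 0) ?addr0.
  by case: eqP; rewrite ?mulr1 ?mulr0.
apply/eqP; rewrite mcoeff_eq0; apply: msize_mdeg_ge.
by rewrite dm mdeg_square // -size_squares.
Qed.

Lemma msize_limit_macdonald mu : is_partition mu -> (msize (L mu) <= (mdeg mu).+1)%N.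
Proof.
move=> hmu; apply: leq_trans (msize_sum _ _ _) _; apply/bigmax_leqP => f _.
apply: leq_trans (mmeasureZ_le _ _ _) _; rewrite /linear_factors.
have [Q [-> sQ]] := prod_linear (index_enum (square mu)) f
  (fun x => - s * q ^+ sq_col x * t^-1 ^+ sq_row x / t ^+ (f x).+1
   + t ^+ (f x).+1 / (- s * q ^+ sq_col x * t^-1 ^+ sq_row x)).
rewrite (leq_trans (msizeD_le _ _)) // geq_max msizeX -/(content f).
rewrite mdeg_content mdeg_square // leqnn (leq_trans sQ) //.
by rewrite size_squares.
Qed.

Lemma mcoeff_limit_macdonald_lead mu : is_partition mu ->
  (L mu)@_mu = tableau_weight q t (min_tableau mu).
Proof.
move=> hmu; rewrite mcoeff_limit_macdonald // (bigD1 (min_tableau mu)) /=; last first.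
  by rewrite content_min.
rewrite big1 ?addr0 // => f /andP[/eqP cE ne]; rewrite /tableau_weight.
case: ifP => // /andP[rw cs]; case/eqP: ne.
by apply: content_min_unique cE => // x; apply: min_tableau_le.
Qed.

(** Monomials of lower degree are smaller in the order; those of top degree are contents of reverse
    tableaux, which lie above the least one. *)
Lemma limit_macdonald_triangular mu m : is_partition mu ->
  (L mu)@_m != 0 -> (m <= mu)%O.
Proof.
move=> hmu nz; have : (mdeg m <= mdeg mu)%N.
  rewrite leqNgt; apply: contraNN nz => lt; rewrite mcoeff_eq0.
  apply: msize_mdeg_ge; exact: leq_trans (msize_limit_macdonald hmu) lt.
rewrite leq_eqVlt => /orP[/eqP dm|lt]; last by apply/ltW/lt_mdeg_ltmc.
move: nz; rewrite mcoeff_limit_macdonald // => nz.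
have [f /eqP <- wf] : exists2 f : {ffun square mu -> 'I_n}, content f == m &
    tableau_weight q t f != 0.
  apply/exists_inP; apply: contraNT nz; rewrite negb_exists_in => /forall_inP h.
  by rewrite big1 // => f /h; rewrite negbK => /eqP.
move: wf; rewrite /tableau_weight; case: ifP; last by rewrite eqxx.
case/andP=> rw cs _; apply: content_le => // x; exact: min_tableau_le.
Qed.

Definition point nu : 'I_n -> F := fun i => bracket q t s i.+1 (nu i).

(** At u = - s q^col t^(-row) the constant of a linear factor is itself minus a bracket. In the
    first row both brackets have the same first index, so the factor vanishes when [nu (f x)] is the
    column index. *)
Lemma meval_limit_macdonald mu nu : (L mu).@[point nu] =
  \sum_(f : {ffun square mu -> 'I_n}) tableau_weight q t f *
    \prod_x (bracket q t s (f x).+1 (nu (f x))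
      - bracket q t s (row_ix x + f x).+1 (col_ix x)).
Proof.
rewrite /limit_macdonald raddf_sum; apply: eq_bigr => f _ /=.
rewrite mevalZ rmorph_prod; congr (_ * _); apply: eq_bigr => x _ /=.
rewrite mevalD mevalXU mevalC /point; congr (_ + _); rewrite /bracket.
rewrite (_ : (row_ix x + f x).+2 = (row_ix x).+1 + (f x).+1)%N; last by lia.
rewrite -[sq_col x]/(col_ix x).+1 -[sq_row x]/(row_ix x).+1 exprD exprVn.
move: (row_ix x).+1 (f x).+1 (col_ix x).+1 => i j k.
by field; rewrite !expf_neq0 ?oppr_eq0 ?s0.
Qed.

Lemma bracket_eq i j i' j' :
  (bracket q t s i j == bracket q t s i' j') = (i == i') && (j == j').
Proof.
apply/eqP/andP => [|[/eqP-> /eqP->] //].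
rewrite /bracket; set y := s * q ^+ j.+1; set z := s * q ^+ j'.+1 => E.
have y0 : y != 0 by rewrite mulf_neq0 ?expf_neq0.
have z0 : z != 0 by rewrite mulf_neq0 ?expf_neq0.
(* From a + 1/a = b + 1/b follows a = b or a b = 1; the second case would equate a monomial
   containing s^2 with one free of s. *)
have : (y * t ^+ i'.+1 - z * t ^+ i.+1) * (y * z - t ^+ i.+1 * t ^+ i'.+1) = 0.
  have -> : (y * t ^+ i'.+1 - z * t ^+ i.+1) * (y * z - t ^+ i.+1 * t ^+ i'.+1)
    = (y / t ^+ i.+1 + t ^+ i.+1 / y - (z / t ^+ i'.+1 + t ^+ i'.+1 / z))
      * (y * z * t ^+ i.+1 * t ^+ i'.+1).
    by field; rewrite y0 z0 !expf_neq0.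
  by rewrite E subrr mul0r.
move/eqP; rewrite mulf_eq0 !subr_eq0 => /orP[/eqP|/eqP].
  have := @ind 1%N j.+1 i'.+1 1%N j'.+1 i.+1; rewrite !expr1 => h.
  by move/h => [_ [->] [->]].
have := @ind 2 (j.+1 + j'.+1)%N 0%N 0%N 0%N (i.+1 + i'.+1)%N.
rewrite !expr0 !mulr1 mul1r expr2 !(exprD q, exprD t) => h E2; have [] // := h _.
by rewrite mulrACA -/y -/z E2.
Qed.

Lemma limit_macdonald_vanishes mu nu : is_partition mu -> is_partition nu ->
  ~~ (mu <= nu)%MM -> (L mu).@[point nu] = 0.
Proof.
move=> hmu hnu; rewrite meval_limit_macdonald => nle; apply: big1 => f _.
rewrite /tableau_weight; case: ifP => [/andP[rw cs]|_]; last by rewrite mul0r.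
have [/existsP[x /andP[/eqP rx /eqP e]]|] :=
    boolP [exists x : square mu, (row_ix x == 0%N) && (nu (f x) == col_ix x)].
  by rewrite [X in _ * X](bigD1 x) //= rx e subrr mul0r mulr0.
rewrite negb_exists => /forallP h; case/negP: nle.
apply: tableau_contained rw cs hnu _ => // x rx e.
by have := h x; rewrite rx e !eqxx.
Qed.

(** Only [min_tableau] survives. A vanishing factor would need a first-row square with [mu] of its
    entry equal to its column, but that entry is less than the column length. *)
Lemma limit_macdonald_diagonal mu : is_partition mu -> (L mu).@[point mu] != 0.
Proof.
move=> hmu; rewrite meval_limit_macdonald (bigD1 (min_tableau mu)) //=.
rewrite [X in _ + X]big1 ?addr0.
  rewrite mulf_neq0 ?tableau_weight_neq0 ?min_tableau_row ?min_tableau_col //.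
  apply/prodf_neq0 => x _; rewrite subr_eq0 bracket_eq.
  apply/negP => /andP[/eqP[rx] /eqP]; rewrite ffunE.
  have [_ r1] := flipP hmu x => e.
  have := lt_conj_part hmu (row_ord (flip x)) (col_ix x).
  by rewrite e ltnn -[nat_of_ord _]/(row_ix (flip x)) -r1 -addnA addn1 -addSnnS leq_addr.
move=> f ne; rewrite /tableau_weight; case: ifP => [/andP[rw cs]|_]; last by rewrite mul0r.
have [/existsP[x /andP[/eqP rx /eqP e]]|] :=
    boolP [exists x : square mu, (row_ix x == 0%N) && (mu (f x) == col_ix x)].
  by rewrite [X in _ * X](bigD1 x) //= rx e subrr mul0r mulr0.
rewrite negb_exists => /forallP h; case/eqP: ne.
apply: tableau_diagonal rw cs _ => // x rx e.
by have := h x; rewrite rx e !eqxx.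
Qed.

End LimitMacdonald.

(** * Interpolation and uniqueness *)

Lemma mnm_le_mdeg_eq n (m1 m2 : 'X_{1..n}) :
  (m1 <= m2)%MM -> (mdeg m2 <= mdeg m1)%N -> m1 = m2.
Proof.
move=> le; rewrite -{1}(submK le) mdegD -[X in (_ <= X)%N]add0n leq_add2r leqn0.
by rewrite mdeg_eq0 => /eqP E; rewrite -(submK le) E add0m.
Qed.

Section Uniqueness.
Variables (F : fieldType) (q t s : F) (n d : nat).
Hypothesis ind : independent q t s.
Local Notation L mu := (limit_macdonald q t s (mu : 'X_{1..n})).

(** The leading monomial of a symmetric polynomial is a partition [m]. Subtracting a multiple of
    [L m] cancels it, and triangularity makes the next leading monomial smaller. *)
Lemma symmetric_expansion (P : {mpoly F[n]}) :
  P \is symmetric -> (msize P <= d.+1)%N ->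
  exists a : 'X_{1..n < d.+1} -> F,
    (forall b : 'X_{1..n < d.+1}, a b != 0 -> is_partition b) /\
    P = \sum_b a b *: L (val b).
Proof.
have [m em] : {m | mlead P = m} by eexists.
elim/(well_founded_ind (@ltom_wf n)): m P em => m IH P em symP sP.
have [->|P0] := eqVneq P 0.
  exists (fun=> 0); split=> [b|]; first by rewrite eqxx.
  by rewrite big1 // => b _; rewrite scale0r.
have hm : is_partition m by move=> i j; rewrite -em; apply: mlead_msym_sorted.
have dm : (mdeg m < d.+1)%N.
  by rewrite -em; apply: leq_trans sP; rewrite mlead_deg.
have cm : (L m)@_m != 0.
  rewrite mcoeff_limit_macdonald_lead //.
  by rewrite (tableau_weight_neq0 ind) ?min_tableau_row ?min_tableau_col.
pose c := P@_m / (L m)@_m; pose P' := P - c *: L m.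
have symP' : P' \is symmetric.
  by rewrite rpredB // rpredZ // limit_macdonald_symmetric.
have sP' : (msize P' <= d.+1)%N.
  rewrite (leq_trans (msizeD_le _ _)) // geq_max sP msizeN.
  rewrite (leq_trans (mmeasureZ_le _ _ _)) //.
  exact: leq_trans (msize_limit_macdonald q t s hm) _.
have [a' [a'P P'E]] : exists a : 'X_{1..n < d.+1} -> F,
    (forall b : 'X_{1..n < d.+1}, a b != 0 -> is_partition b) /\
    P' = \sum_b a b *: L (val b).
  (* Treated apart because the leading monomial of 0 is by convention the unit monomial, which may
     not be smaller than [m]. *)
  have [P'0|P'0] := eqVneq P' 0.
    exists (fun=> 0); split=> [b|]; first by rewrite eqxx.
    by rewrite P'0 big1 // => b _; rewrite scale0r.
  apply: IH (erefl _) symP' sP'; rewrite lt_neqAle.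
  have := mlead_supp P'0; rewrite mcoeff_msupp => nz; apply/andP; split.
    by apply: contraNneq nz => ->; rewrite mcoeffB mcoeffZ divfK // subrr.
  have [Pz|Pnz] := eqVneq P@_(mlead P') 0; last first.
    by rewrite -em; apply: msupp_le_mlead; rewrite mcoeff_msupp.
  apply: (@limit_macdonald_triangular F q t s n m _ hm).
  apply: contraNneq nz => Lz.
  by rewrite {1}/P' mcoeffB mcoeffZ Pz Lz mulr0 subr0.
exists (fun b => a' b + (if val b == m then c else 0)); split=> [b|].
  have [e _|_] := eqVneq (val b) m; last by rewrite addr0; exact: a'P.
  by rewrite -[bmnm b]/(val b) e.
have -> : P = P' + c *: L m by rewrite subrK.
rewrite P'E; under [RHS]eq_bigr do rewrite scalerDl.
rewrite big_split /=; congr (_ + _).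
rewrite (bigD1 (BMultinom dm)) //= eqxx big1 ?addr0 // => b ne.
by rewrite (_ : val b == m = false) ?scale0r //; apply: contraNF ne.
Qed.

(** Take [b] of least degree in the expansion. At the point of [b] every other term vanishes, since
    containment in [b] would force equality, while [L b] does not. *)
Lemma symmetric_eq0 (P : {mpoly F[n]}) :
  P \is symmetric -> (msize P <= d.+1)%N ->
  (forall nu, is_partition nu -> (mdeg nu <= d)%N -> P.@[point q t s nu] = 0) ->
  P = 0.
Proof.
move=> symP sP P0; have [a [aP E]] := symmetric_expansion symP sP.
have [/existsP[b0 ab0]|] := boolP [exists b, a b != 0]; last first.
  rewrite negb_exists => /forallP h; rewrite E big1 // => b _.
  by have := h b; rewrite negbK => /eqP ->; rewrite scale0r.
case: (@arg_minnP _ b0 (fun b => a b != 0) (fun b => mdeg (val b)) ab0) => b ab bmin.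
have hb := aP _ ab.
have := P0 (val b) hb (bmdeg b); rewrite E raddf_sum (bigD1 b) //= big1 ?addr0.
  move/eqP; rewrite mevalZ mulf_eq0 (negPf ab) /=.
  by rewrite (negPf (limit_macdonald_diagonal ind hb)).
move=> b' ne; rewrite mevalZ; have [->|ab'] := eqVneq (a b') 0; first by rewrite mul0r.
rewrite limit_macdonald_vanishes ?mulr0 //; first exact: aP.
by apply: contra ne => le; apply/eqP/val_inj/mnm_le_mdeg_eq => //; exact: bmin.
Qed.

End Uniqueness.

Lemma limit_macdonald_interpolation (F : fieldType) (q t s : F) n (lam : 'X_{1..n}) :
  independent q t s -> is_partition lam ->
  unique (is_interpolation_macdonald q t s lam)
    ((tableau_weight q t (min_tableau lam))^-1 *: limit_macdonald q t s lam).
Proof.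
move=> ind hlam; set c := tableau_weight _ _ _; set L := limit_macdonald _ _ _ _.
have cE : L@_lam = c by exact: mcoeff_limit_macdonald_lead.
have c0' : c != 0.
  by rewrite (tableau_weight_neq0 ind) ?min_tableau_row ?min_tableau_col.
have LL : c^-1 *: L \is symmetric.
  by apply: symmetricZ; exact: limit_macdonald_symmetric.
have Lc : (c^-1 *: L)@_lam = 1 by rewrite mcoeffZ cE mulVf.
have Ls : (msize (c^-1 *: L) <= (mdeg lam).+1)%N.
  exact: leq_trans (mmeasureZ_le _ _ _) (msize_limit_macdonald _ _ _ hlam).
have Lv nu : is_partition nu -> ~~ (lam <= nu)%MM ->
    (c^-1 *: L).@[point q t s nu] = 0.
  by move=> hnu le; rewrite mevalZ limit_macdonald_vanishes ?mulr0.
split.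
  split=> //; split=> //; apply: contraTneq (oner_neq0 F) => J0.
  by rewrite -Lc J0 mcoeff0 eqxx.
move=> I [[I0 symI sI vI] I1].
pose D := I - c^-1 *: L.
(* Among partitions of size at most that of [lam], only [lam] contains it; [k] corrects the value
   there. Comparing coefficients of x^lam then gives [k] = 0. *)
pose k := D.@[point q t s lam] / L.@[point q t s lam].
have DE : D - k *: L = 0.
  apply: (symmetric_eq0 ind (d := mdeg lam)) => [||nu hnu dnu].
  - by rewrite !rpredB ?symmetricZ ?limit_macdonald_symmetric.
  - rewrite (leq_trans (msizeD_le _ _)) // geq_max (leq_trans (msizeD_le _ _)) /=.
      by rewrite msizeN (leq_trans (mmeasureZ_le _ _ _)) // msize_limit_macdonald.
    by rewrite geq_max sI msizeN Ls.
  rewrite mevalB mevalZ; have [le|nle] := boolP (lam <= nu)%MM.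
    rewrite -(mnm_le_mdeg_eq le dnu).
    by rewrite divfK ?subrr // limit_macdonald_diagonal.
  by rewrite mevalB Lv // vI // limit_macdonald_vanishes // mulr0 subrr subr0.
have k0 : k = 0.
  have := congr1 (mcoeff lam) DE; rewrite !mcoeffB I1 Lc subrr mcoeffZ cE mcoeff0.
  by rewrite sub0r => /eqP; rewrite oppr_eq0 mulf_eq0 (negPf c0') orbF => /eqP.
move/eqP: DE; rewrite k0 scale0r subr0 subr_eq0 => /eqP DE.
by rewrite -DE.
Qed.

(** The constant is the weight of the least tableau. Weights do not involve s, so it is computed in
    [Qqt] and carried over by [cst]. *)
Theorem theorem2 (n : nat) (hn : (1 <= n)%N) (lam : 'X_{1..n})
    (hlam : is_partition lam) (hd : (1 <= mdeg lam)%N) :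
  exists I : {mpoly Qqts[n]},
    unique (is_interpolation_macdonald q_ t_ s_ lam) I /\
    exists c : Qqt, c != 0 /\
      mpoly_limit (t_^-1)
        ((1 - r_ * cst t_) ^+ (part_length lam - 1) *:
           macdonald_qtsr lam (cst q_) (cst t_) (cst s_) r_)
        ((cst c : Qqts) *: I).
Proof.
have ind := independent_qts.
pose c : Qqt := tableau_weight (cst (indet rat)) (indet (ratfun rat)) (min_tableau lam).
have cE : tableau_weight q_ t_ (min_tableau lam) = cst c.
  exact: (esym (fmorph_tableau_weight (cst_morph _) _ _ _)).
have c0 : cst c != 0.
  by rewrite -cE (tableau_weight_neq0 ind) ?min_tableau_row ?min_tableau_col.
exists ((cst c)^-1 *: limit_macdonald q_ t_ s_ lam); split.
  by rewrite -cE; exact: limit_macdonald_interpolation.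
exists c; split; first by rewrite -(fmorph_eq0 (cst_morph _)).
rewrite scalerA divff // scale1r subn1.
exact: limit_macdonaldP.
Qed.
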